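(* For every $m,n\in\mathbb Z_+$ the map $\psi_{m,n}\colon\mathbbm k\mathcal F_{\mathbf{Ab}}(x_1,\dots,x_m)^{\otimes n}\to\mathcal P_{\mathbf{CommCocHopf}}(\mathbbm k)(m,n)$ is a linear bijection. Moreover, if $\mathcal F_{\mathbf{Ab}}(x_1,x_2,\dots)$ is the free abelian group of countable rank, then the (multilinear) polynomial identities with coefficients in $\mathbbm k$ of the group Hopf algebra $\mathbbm k\mathcal F_{\mathbf{Ab}}(x_1,x_2,\dots)$ are generated by $V_{\mathbf{CommCocHopf}}$, i.e. (over the Hopf algebra axioms) by the commutativity identity $xy-yx\equiv0$ and the cocommutativity identity $x_{(1)}\otimes x_{(2)}-x_{(2)}\otimes x_{(1)}\equiv0$.
   Context: $\mathbbm k$ is a field. Let $\Omega=\{\mu,u,\Delta,\varepsilon,S\}$ with $(s,t)$ equal to $(2,1),(0,1),(1,2),(1,0),(1,1)$ respectively. $\mathcal M(\Omega)$ is the free braided strict monoidal category on one object $1$ and morphisms $\omega\colon1^{\otimes s(\omega)}\to1^{\otimes t(\omega)}$ (objects $\mathbb Z_+$, $m\otimes n=m+n$, morphisms generated by identities, braidings $\tau_{m,n}$, their inverses and the $\omega$'s modulo the relations of a braided strict monoidal category); $\mathcal P(\mathbbm k,\Omega)(m,n)$ is the vector space with basis $\mathcal M(\Omega)(m,n)$. For $V\subseteq\mathcal P(\mathbbm k,\Omega)$, $\mathcal P_V(\mathbbm k,\Omega)$ is the quotient by the smallest monoidal ideal (subspaces closed under composition on both sides and $\otimes$ with arbitrary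 morphisms) containing $V$. A Hopf algebra $H$ is an $\Omega$-algebra; $\mathcal E_H\colon\mathcal P(\mathbbm k,\Omega)\to\mathbf{Vect}_{\mathbbm k}$ is the linear braided monoidal functor with $n\mapsto H^{\otimes n}$, $\omega\mapsto$ structure map, $\tau_{m,n}\mapsto$ flip; $f\equiv 0$ is a polynomial identity of $H$ if $\mathcal E_H(f)=0$; $V$ generates the identities of $H$ if $\mathcal E_H$ vanishes on $V$ and every identity of $H$ has zero image in $\mathcal P_V(\mathbbm k,\Omega)$. $V_{\mathbf{Hopf}}$ consists of $\tau_{1,1}^2-\mathrm{id}_2$, $\mu(\mu\otimes\mathrm{id}_1)-\mu(\mathrm{id}_1\otimes\mu)$, $\mu(u\otimes\mathrm{id}_1)-\mathrm{id}_1$, $\mu(\mathrm{id}_1\otimes u)-\mathrm{id}_1$, $(\Delta\otimes\mathrm{id}_1)\Delta-(\mathrm{id}_1\otimes\Delta)\Delta$, $(\varepsilon\otimes\mathrm{id}_1)\Delta-\mathrm{id}_1$, $(\mathrm{id}_1\otimes\varepsilon)\Delta-\mathrm{id}_1$, $\varepsilon u-\mathrm{id}_0$, $\varepsilon\mu-\varepsilon\otimes\varepsilon$, $\Delta u-u\otimes u$, $\Delta\mu-(\mu\otimes\mu)(\mathrm{id}_1\otimes\tau_{1,1}\otimes\mathrm{id}_1)(\Delta\otimes\Delta)$, $\mu(S\otimes\mathrm{id}_1)\Delta-u\varepsilon$, $\mu(\mathrm{id}_1\otimes S)\Delta-u\varepsilon$. $V_{\mathbf{CommCocHopf}}:=V_{\mathbf{Hopf}}\cup\{\Delta-\tau_{1,1}\Delta,\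 \mu-\mu\tau_{1,1}\}$, $\mathcal P_{\mathbf{CommCocHopf}}(\mathbbm k):=\mathcal P_{V_{\mathbf{CommCocHopf}}}(\mathbbm k,\Omega)$. Functional notation: an expression in $x_1,\dots,x_m$ denotes the morphism that applies to the $q$-th input $\varepsilon$ (written $\varepsilon(x_q)$) or the iterated comultiplication producing $x_{q(1)}\otimes\dots\otimes x_{q(p)}$ (with $x_{q(1)}:=x_q$ if $p=1$), then permutes factors by symmetric braidings, applies $S$ where indicated, multiplies juxtaposed factors by $\mu$, and uses $u$ for empty products. $\mathcal F_{\mathbf{Ab}}(x_1,\dots,x_m)$ is the free abelian group written multiplicatively; the standard basis of $\mathbbm k\mathcal F_{\mathbf{Ab}}(x_1,\dots,x_m)^{\otimes n}$ consists of $g=\bigotimes_{k=1}^n\prod_{r=1}^m x_r^{s_{kr}}$, $s_{kr}\in\mathbb Z$. Then $\psi_{m,n}(g):=\varepsilon(x_{i_1})\cdots\varepsilon(x_{i_s})\bigotimes_{k=1}^n\prod_{r=1}^m\prod_{j=1}^{p_{kr}}S^{\alpha_{kr}}x_{r(\beta_{krj})}$, where $p_{kr}:=|s_{kr}|$, $\alpha_{kr}:=0$ if $s_{kr}\geqslant0$ and $1$ otherwise, $\{i_1<\dots<i_s\}=\{r\mid \sum_k p_{kr}=0\}$, for each $r$ the sequence $(\beta_{1r1},\dots,\beta_{1rp_{1r}},\beta_{2r1},\dots,\beta_{nrp_{nr}})=(1,2,\dots,\sum_kp_{kr})$, and $x_{r(1)}:=x_r$ if $\sum_kp_{kr}=1$;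 $\psi_{m,n}$ is extended linearly. *)

(* Defs.v *)
From HB Require Import structures.
From mathcomp Require Import all_boot all_order all_algebra.
From mathcomp Require Import freeg.
Set Implicit Arguments. Unset Strict Implicit. Unset Printing Implicit Defensive.
Import Order.TTheory GRing.Theory Num.Theory.

Inductive gen := Gmu | Gu | GDelta | Geps | GS.

Definition gsrc (g : gen) : nat :=
  match g with Gmu => 2 | Gu => 0 | GDelta => 1 | Geps => 1 | GS => 1 end.
Definition gtgt (g : gen) : nat :=
  match g with Gmu => 1 | Gu => 1 | GDelta => 2 | Geps => 0 | GS => 1 end.

(* Raw morphism terms of the free braided strict monoidal category.
   Comp f g = f o g (g applied first).  Br m n = tau_{m,n} : m+n -> n+m,
   BrInv m n = tau_{m,n}^{-1} : n+m -> m+n. *)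
Inductive tm :=
| Id of nat
| Br of nat & nat
| BrInv of nat & nat
| Gen of gen
| Comp of tm & tm
| Tens of tm & tm.

Lemma tm_eq_dec : comparable tm.
Proof. move=> x y; rewrite /decidable; decide equality; decide equality. Qed.
HB.instance Definition _ := hasDecEq.Build tm (compareP tm_eq_dec).

Inductive typed : tm -> nat -> nat -> Prop :=
| ty_id n : typed (Id n) n n
| ty_br m n : typed (Br m n) (m + n) (n + m)
| ty_brinv m n : typed (BrInv m n) (n + m) (m + n)
| ty_gen g : typed (Gen g) (gsrc g) (gtgt g)
| ty_comp f g l m n : typed g l m -> typed f m n -> typed (Comp f g) l n
| ty_tens f g m n p q : typed f m n -> typed g p q -> typed (Tens f g) (m + p) (n + q).

Inductive bmc_rel : tm -> tm -> Prop :=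
| bmc_idl f m n : typed f m n -> bmc_rel (Comp (Id n) f) f
| bmc_idr f m n : typed f m n -> bmc_rel (Comp f (Id m)) f
| bmc_assoc f g h a b c d : typed h a b -> typed g b c -> typed f c d ->
    bmc_rel (Comp (Comp f g) h) (Comp f (Comp g h))
| bmc_tunitl f m n : typed f m n -> bmc_rel (Tens (Id 0) f) f
| bmc_tunitr f m n : typed f m n -> bmc_rel (Tens f (Id 0)) f
| bmc_tassoc f g h a b c d e i : typed f a b -> typed g c d -> typed h e i ->
    bmc_rel (Tens (Tens f g) h) (Tens f (Tens g h))
| bmc_tid m n : bmc_rel (Tens (Id m) (Id n)) (Id (m + n))
| bmc_interchange f f' g g' a b c p q r :
    typed f' a b -> typed f b c -> typed g' p q -> typed g q r ->
    bmc_rel (Comp (Tens f g) (Tens f' g')) (Tens (Comp f f') (Comp g g'))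
| bmc_nat f g m m' n n' : typed f m m' -> typed g n n' ->
    bmc_rel (Comp (Br m' n') (Tens f g)) (Comp (Tens g f) (Br m n))
| bmc_hex1 l m n :
    bmc_rel (Br l (m + n)) (Comp (Tens (Id m) (Br l n)) (Tens (Br l m) (Id n)))
| bmc_hex2 l m n :
    bmc_rel (Br (l + m) n) (Comp (Tens (Br l n) (Id m)) (Tens (Id l) (Br m n)))
| bmc_inv1 m n : bmc_rel (Comp (Br m n) (BrInv m n)) (Id (n + m))
| bmc_inv2 m n : bmc_rel (Comp (BrInv m n) (Br m n)) (Id (m + n)).

Section Linear.
Variable F : fieldType.

(* A (representation of a) vector of the free F-vector space on terms:
   a finite formal linear combination. *)
Definition comb := seq (F * tm).
Definition coef (c : comb) (t : tm) : F := (\sum_(p <- c | p.2 == t) p.1)%R.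
Definition typed_comb (m n : nat) (c : comb) := forall p, p \in c -> typed p.2 m n.
Definition scale (a : F) (c : comb) : comb := [seq ((a * p.1)%R, p.2) | p <- c].
Definition lcomp (h : tm) (c : comb) : comb := [seq (p.1, Comp h p.2) | p <- c].
Definition rcomp (c : comb) (h : tm) : comb := [seq (p.1, Comp p.2 h) | p <- c].
Definition ltens (h : tm) (c : comb) : comb := [seq (p.1, Tens h p.2) | p <- c].
Definition rtens (c : comb) (h : tm) : comb := [seq (p.1, Tens p.2 h) | p <- c].

Definition family := nat -> nat -> comb -> Prop.

(* Ideal V m n c : the class of c in P(k,Omega)(m,n) lies in the smallest
   monoidal ideal containing V, i.e. c is zero in P_V(k,Omega)(m,n).
   (The relations of the free braided strict monoidal category are
   included as generators, which yields exactly the preimage in the free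
   vector space on raw terms.) *)
Inductive Ideal (V : family) : nat -> nat -> comb -> Prop :=
| Id_gen m n c : V m n c -> typed_comb m n c -> Ideal V m n c
| Id_bmc m n t1 t2 : typed t1 m n -> typed t2 m n -> bmc_rel t1 t2 ->
    Ideal V m n [:: (1%R, t1); ((-1)%R, t2)]
| Id_nil m n : Ideal V m n [::]
| Id_rep m n c c' : Ideal V m n c -> typed_comb m n c' ->
    (forall t, coef c t = coef c' t) -> Ideal V m n c'
| Id_add m n c1 c2 : Ideal V m n c1 -> Ideal V m n c2 -> Ideal V m n (c1 ++ c2)
| Id_scale m n a c : Ideal V m n c -> Ideal V m n (scale a c)
| Id_lcomp m n p h c : typed h n p -> Ideal V m n c -> Ideal V m p (lcomp h c)
| Id_rcomp l m n h c : typed h l m -> Ideal V m n c -> Ideal V l n (rcomp c h)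
| Id_ltens m n p q h c : typed h p q -> Ideal V m n c -> Ideal V (p + m) (q + n) (ltens h c)
| Id_rtens m n p q h c : typed h p q -> Ideal V m n c -> Ideal V (m + p) (n + q) (rtens c h).

Definition eqP_V (V : family) m n (c1 c2 : comb) := Ideal V m n (c1 ++ scale (-1)%R c2).

Definition tau11 := Br 1 1.
Definition mu := Gen Gmu.  Definition un := Gen Gu.
Definition De := Gen GDelta. Definition ep := Gen Geps. Definition Sg := Gen GS.
Definition diff (t1 t2 : tm) : comb := [:: (1%R, t1); ((-1)%R, t2)].

Inductive V_Hopf : family :=
| vh1 : V_Hopf 2 2 (diff (Comp tau11 tau11) (Id 2))
| vh2 : V_Hopf 3 1 (diff (Comp mu (Tens mu (Id 1))) (Comp mu (Tens (Id 1) mu)))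
| vh3 : V_Hopf 1 1 (diff (Comp mu (Tens un (Id 1))) (Id 1))
| vh4 : V_Hopf 1 1 (diff (Comp mu (Tens (Id 1) un)) (Id 1))
| vh5 : V_Hopf 1 3 (diff (Comp (Tens De (Id 1)) De) (Comp (Tens (Id 1) De) De))
| vh6 : V_Hopf 1 1 (diff (Comp (Tens ep (Id 1)) De) (Id 1))
| vh7 : V_Hopf 1 1 (diff (Comp (Tens (Id 1) ep) De) (Id 1))
| vh8 : V_Hopf 0 0 (diff (Comp ep un) (Id 0))
| vh9 : V_Hopf 2 0 (diff (Comp ep mu) (Tens ep ep))
| vh10 : V_Hopf 0 2 (diff (Comp De un) (Tens un un))
| vh11 : V_Hopf 2 2 (diff (Comp De mu)
     (Comp (Tens mu mu) (Comp (Tens (Id 1) (Tens tau11 (Id 1))) (Tens De De))))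
| vh12 : V_Hopf 1 1 (diff (Comp mu (Comp (Tens Sg (Id 1)) De)) (Comp un ep))
| vh13 : V_Hopf 1 1 (diff (Comp mu (Comp (Tens (Id 1) Sg) De)) (Comp un ep)).

Inductive V_CommCocHopf : family :=
| vcc_hopf m n c : V_Hopf m n c -> V_CommCocHopf m n c
| vcc_cocomm : V_CommCocHopf 1 2 (diff De (Comp tau11 De))
| vcc_comm : V_CommCocHopf 2 1 (diff mu (Comp mu tau11)).

End Linear.

Fixpoint tens_list (l : seq tm) : tm :=
  match l with [::] => Id 0 | t :: l' => Tens t (tens_list l') end.

Fixpoint Dn (p : nat) : tm :=
  match p with
  | O => ep | S O => Id 1
  | S (S q as q') => Comp (Tens De (Id q)) (Dn q')
  end.

Fixpoint Mn (p : nat) : tm :=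
  match p with
  | O => un | S O => Id 1
  | S (S _ as q') => Comp mu (Tens (Mn q') (Id 1))
  end.

(* permutation of N strands by braidings: output position i carries the
   input strand (nth i ord); ord is a permutation of iota 0 N *)
Fixpoint permt (N : nat) (ord : seq nat) : tm :=
  match N, ord with
  | S N', j :: rest =>
      Comp (Tens (Id 1) (permt N' [seq (if i < j then i else i.-1)%N | i <- rest]))
           (Tens (Br j 1) (Id (N' - j)%N))
  | _, _ => Id 0
  end.

Section Psi.
Variables m n : nat.
Variable s : 'M[int]_(n, m).   (* s k r = exponent of x_r in the k-th factor *)

Definition pkr (k : 'I_n) (r : 'I_m) : nat := `|s k r|%N.
Definition Nr (r : 'I_m) : nat := (\sum_(k < n) pkr k r)%N.
Definition Pk (k : 'I_n) : nat := (\sum_(r < m) pkr k r)%N.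
Definition off (r : 'I_m) : nat := (\sum_(r' < m | (r' < r)%N) Nr r')%N.
Definition before (k : 'I_n) (r : 'I_m) : nat := (\sum_(k' < n | (k' < k)%N) pkr k' r)%N.

Definition psi_D : tm := tens_list [seq Dn (Nr r) | r <- enum 'I_m].
Definition psi_ord : seq nat :=
  flatten [seq flatten [seq [seq (off r + before k r + j)%N | j <- iota 0 (pkr k r)]
                         | r <- enum 'I_m] | k <- enum 'I_n].
Definition psi_P : tm := permt (\sum_(r < m) Nr r)%N psi_ord.
Definition psi_S : tm :=
  tens_list (flatten [seq flatten [seq nseq (pkr k r) (if (s k r < 0)%R then Sg else Id 1)
                                   | r <- enum 'I_m] | k <- enum 'I_n]).
Definition psi_M : tm := tens_list [seq Mn (Pk k) | k <- enum 'I_n].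

Definition psi_term : tm := Comp psi_M (Comp psi_S (Comp psi_P psi_D)).
End Psi.

Section PsiLin.
Variable F : fieldType.
Variables m n : nat.
(* a vector of k F_Ab(x_1..x_m)^{(x) n}, as a formal combination of the
   standard basis, indexed by the exponent matrices (s_{kr}) *)
Definition fcomb := seq (F * 'M[int]_(n, m)).
Definition fcoef (f : fcomb) (s : 'M[int]_(n, m)) : F := (\sum_(p <- f | p.2 == s) p.1)%R.
Definition psi (f : fcomb) : comb F := [seq (p.1, psi_term p.2) | p <- f].
End PsiLin.

(* E_H for H = k[G], G = free abelian group of countable rank (written
   additively), H^{(x) n} = k[G^n]; every structure map sends basis
   tuples to basis tuples, so E_H(t) is the linear extension of eval t. *)
Definition G := {freeg nat}.

Fixpoint src (t : tm) : nat :=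
  match t with
  | Id n => n | Br m n => m + n | BrInv m n => n + m | Gen g => gsrc g
  | Comp f g => src g | Tens f g => src f + src g
  end.

Definition eval_gen (g : gen) (x : seq G) : seq G :=
  match g with
  | Gmu => [:: (nth 0%R x 0%N + nth 0%R x 1%N)%R]
  | Gu => [:: 0%R]
  | GDelta => [:: nth 0%R x 0%N; nth 0%R x 0%N]
  | Geps => [::]
  | GS => [:: (- nth 0%R x 0%N)%R]
  end.

Fixpoint eval (t : tm) (x : seq G) : seq G :=
  match t with
  | Id _ => x
  | Br m _ => drop m x ++ take m x
  | BrInv _ n => drop n x ++ take n x
  | Gen g => eval_gen g x
  | Comp f g => eval f (eval g x)
  | Tens f g => eval f (take (src f) x) ++ eval g (drop (src f) x)
  end.

(* E_H(c) = 0 for c in P(k,Omega)(m,n): its value on every basis tensor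
   x in G^m vanishes, i.e. every coefficient of the result is 0. *)
Definition EH_zero (F : fieldType) (m : nat) (c : comb F) :=
  forall x : seq G, size x = m ->
  forall y : seq G, (\sum_(p <- c | eval p.2 x == y) p.1 = 0)%R.

(* Main.v *)
Require Import Defs.
From mathcomp Require Import all_boot all_order all_algebra.
From mathcomp Require Import zify ring freeg.
From Stdlib Require Import Setoid Morphisms.
Set Implicit Arguments. Unset Strict Implicit. Unset Printing Implicit Defensive.
Import GRing.Theory.

(** Modulo the ideal the category becomes cartesian: every morphism is
    compatible with the iterated comultiplications [diag m : m -> m + m] and
    counits [eps m : m -> 0].  For the antipode this is the uniqueness of the
    convolution inverse of [De] in [Hom(1, 2)].  Hence a morphism [m -> n] is
    determined by its [n] projections in [Hom(m, 1)], and [Hom(m, 1)] is an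
    abelian group under convolution.  By induction on terms all projections lie
    in the subgroup spanned by the coordinate projections of [m], so a morphism
    is determined by an integer matrix.  Evaluating in the group Hopf algebra
    on the free generators reads this matrix off again, and [psi_term s]
    evaluates to [s]; this gives bijectivity of [psi] and the description of
    the identities at once. *)

Local Notation "f \oo g" := (Comp f g) (at level 50, left associativity).
Local Notation "f ** g" := (Tens f g) (at level 45, left associativity).

(** Every generator of the ideal is a difference of two terms, so the quotient is the linearization
    of a quotient category. The argument therefore lives on single terms modulo [teq]; linear
    combinations return only for soundness of evaluation and in the last section. The obstacle is
    that several facts a cartesian category takes for granted are not axioms. Only [tau11] is
    assumed involutive: symmetry of every [Br m n] comes from the hexagons and removes [BrInv]. No
    axiom relates [Sg] to [De] except the antipode laws; in a general Hopf algebra the antipode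
    reverses the comultiplication, and cocommutativity is what removes the flip. Commutativity of
    [mu] enters only to make convolution abelian. The term [psi_term s], with its permutation of
    strands, is never simplified by diagrams. Its projections are integer combinations of
    coordinates like those of any term, and evaluation at free generators finds the integers. *)

Fixpoint tgt (t : tm) : nat :=
  match t with
  | Id n => n | Br m n => n + m | BrInv m n => m + n | Gen g => gtgt g
  | Comp f g => tgt f | Tens f g => tgt f + tgt g
  end.

Fixpoint wt (t : tm) : bool :=
  match t with
  | Comp f g => [&& wt f, wt g & tgt g == src f]
  | Tens f g => wt f && wt g
  | _ => true
  end.

(** Computed arities replace the indices of [typed], so that typing conditions become equations in
    [nat] within reach of [lia]. *)
Lemma typedE t m n : typed t m n <-> [/\ wt t, src t = m & tgt t = n].
Proof.
split.
  elim=> //= {t m n}.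
    by move=> f g l m n _ [-> <- <-] _ [-> -> <-]; rewrite eqxx.
  by move=> f g m n p q _ [-> <- <-] _ [-> <- <-].
case=> + <- <-; elim: t => /= [n0|m0 n0|m0 n0|g|f IHf g IHg|f IHf g IHg].
- by constructor.
- by constructor.
- by constructor.
- by constructor.
- by move=> /and3P[wf wg /eqP e]; apply: ty_comp (IHf wf); rewrite -e; apply: IHg.
- by move=> /andP[wf wg]; apply: ty_tens; [apply: IHf|apply: IHg].
Qed.

Lemma typed_src t m n : typed t m n -> src t = m.
Proof. by case/typedE. Qed.

Lemma coef_indic (F : fieldType) (c : comb F) t :
  coef c t = (\sum_(p <- c) p.1 * (p.2 == t)%:R)%R.
Proof.
by rewrite /coef big_mkcond; apply: eq_bigr => p _; case: eqP => _;
  rewrite ?mulr1 ?mulr0.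
Qed.

(** * Equality of terms modulo the ideal, as a congruence *)

Section Teq.
Variable F : fieldType.
Local Notation V := (@V_CommCocHopf F).

Lemma diff_typed m n (t t' : tm) :
  typed t m n -> typed t' m n -> typed_comb m n (diff F t t').
Proof. by move=> h h' p; rewrite !inE => /orP[] /eqP->. Qed.

(* Ill-typed terms are all identified, so that the congruence and
   associativity laws hold without typing side conditions. *)
Definition teq (t t' : tm) : Prop := wt t = wt t' /\
  (wt t -> [/\ src t = src t', tgt t = tgt t' &
               Ideal V (src t) (tgt t) (diff F t t')]).
Local Notation "t ~~~ t'" := (teq t t') (at level 70).

Lemma teq_ideal m n t t' : typed t m n -> t ~~~ t' -> Ideal V m n (diff F t t').
Proof. by move=> /typedE[w <- <-] [_ /(_ w)[]]. Qed.

Lemma teq_typed m n t t' : typed t m n -> t ~~~ t' -> typed t' m n.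
Proof. by move=> /typedE[w <- <-] [ww /(_ w)[]] -> -> _; apply/typedE; rewrite -ww. Qed.

Lemma teqI t t' : (wt t' -> wt t) ->
  (wt t -> [/\ wt t', src t = src t', tgt t = tgt t' &
             Ideal V (src t) (tgt t) (diff F t t')]) -> t ~~~ t'.
Proof.
move=> h1 h2; split; last by move/h2 => [].
by apply/idP/idP => [/h2[]|/h1].
Qed.

Lemma teqP m n t t' : typed t m n -> typed t' m n ->
  Ideal V m n (diff F t t') -> t ~~~ t'.
Proof.
move=> /typedE[w s g] /typedE[w' s' g'] h; apply: teqI => // _.
by rewrite s s' g g'.
Qed.

Lemma teq_refl t : t ~~~ t.
Proof.
(* [diff F t t] is a nonempty list whose coefficients cancel, hence the comparison with the empty
   combination. *)
apply: teqI => // w; split=> //; apply: Id_rep; first exact: Id_nil.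
  by apply: diff_typed; apply/typedE.
by move=> s; rewrite !coef_indic !big_cons big_nil /=; ring.
Qed.

#[local] Hint Resolve teq_refl : core.

Lemma teq_sym t t' : t ~~~ t' -> t' ~~~ t.
Proof.
case=> ww h; split=> // w'; have w : wt t by rewrite ww.
case: (h w) => <- <- h'; split=> //.
apply: Id_rep (Id_scale (-1)%R h') _ _ => [|s].
  by apply: diff_typed; apply/typedE; split=> //; case: (h w).
by rewrite !coef_indic !big_cons big_nil /=; ring.
Qed.

Lemma teq_trans t1 t2 t3 : t1 ~~~ t2 -> t2 ~~~ t3 -> t1 ~~~ t3.
Proof.
case=> w12 h12 [w23 h23]; split=> [|w1]; first by rewrite w12.
have w2 : wt t2 by rewrite -w12.
have [s12 g12 i12] := h12 w1; have [s23 g23 i23] := h23 w2.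
rewrite -s23 -g23; split=> //; rewrite -s12 -g12 in i23.
apply: Id_rep (Id_add i12 i23) _ _ => [|s].
  by apply: diff_typed; apply/typedE; rewrite s12 g12 ?s23 ?g23 -?w23.
by rewrite !coef_indic !big_cons big_nil /=; ring.
Qed.

Global Instance teq_equiv : Equivalence teq.
Proof. split; [exact: teq_refl|exact: teq_sym|exact: teq_trans]. Qed.

(** Telescoping: [f g - f' g' = f (g - g') + (f - f') g'], and the ideal is closed under composition
    on either side. The instance for [Tens] has the same proof. *)
Global Instance teq_comp : Proper (teq ==> teq ==> teq) Comp.
Proof.
move=> f f' [wf hf] g g' [wg hg].
have ww : wt (f \oo g) = wt (f' \oo g').
  rewrite /= -wf -wg; case: (wt f) hf => //= /(_ isT)[-> _ _].
  by case: (wt g) hg => //= /(_ isT)[_ -> _].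
split=> // w; have /= /and3P[w1 w2 /eqP e] := w.
have := hf w1 => -[sf tf If]; have := hg w2 => -[sg tg Ig]; split=> //=.
have tyf : typed f (tgt g) (tgt f) by apply/typedE.
have tyg' : typed g' (src g) (tgt g) by apply/typedE; split; rewrite // -wg.
rewrite -e in If; have I1 := Id_lcomp tyf Ig; have I2 := Id_rcomp tyg' If.
apply: Id_rep (Id_add I1 I2) _ _ => [|s].
  apply: diff_typed; apply/typedE => //; rewrite -ww /=.
  by split; rewrite ?w1 ?w2 ?e ?eqxx.
by rewrite !coef_indic !big_cons big_nil /=; ring.
Qed.

Global Instance teq_tens : Proper (teq ==> teq ==> teq) Tens.
Proof.
move=> f f' [wf hf] g g' [wg hg].
have ww : wt (f ** g) = wt (f' ** g') by rewrite /= -wf -wg.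
split=> // w; have /= /andP[w1 w2] := w.
have := hf w1 => -[sf tf If]; have := hg w2 => -[sg tg Ig]; split=> //=.
- by rewrite sf sg.
- by rewrite tf tg.
have tyf : typed f (src f) (tgt f) by apply/typedE.
have tyg' : typed g' (src g) (tgt g) by apply/typedE; split; rewrite // -wg.
have I1 := Id_ltens tyf Ig; have I2 := Id_rtens tyg' If.
apply: Id_rep (Id_add I1 I2) _ _ => [|s].
  apply: diff_typed; apply/typedE; rewrite -?ww //=.
  by split; rewrite ?w1 ?w2 ?sf ?sg ?tf ?tg.
by rewrite !coef_indic !big_cons big_nil /=; ring.
Qed.

Lemma teq_bmc t t' : (wt t' -> wt t) ->
  (wt t -> [/\ wt t', src t = src t', tgt t = tgt t' & bmc_rel t t']) -> t ~~~ t'.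
Proof.
move=> h1 h2; apply: teqI => // w; have [w' s' g' r] := h2 w; split=> //.
by apply: Id_bmc => //; apply/typedE.
Qed.

Lemma wt_typed t : wt t -> typed t (src t) (tgt t). Proof. by move=> w; apply/typedE. Qed.

Lemma teq_gen m n t t' : V m n (diff F t t') ->
  typed t m n -> typed t' m n -> t ~~~ t'.
Proof. by move=> h w w'; apply: (teqP w w'); apply: Id_gen h _; apply: diff_typed. Qed.

Lemma cmpA f g h : (f \oo g) \oo h ~~~ f \oo (g \oo h).
Proof.
apply: teq_bmc => /=; first by move=> /and3P[-> /and3P[-> -> ->] ->].
move=> /and3P[/and3P[wf wg /eqP e] wh /eqP e'].
rewrite wf wg wh e e' !eqxx; split=> //.
apply: (@bmc_assoc _ _ _ (src h) (tgt h) (tgt g) (tgt f)); first exact: wt_typed.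
  by rewrite e'; apply: wt_typed.
by rewrite e; apply: wt_typed.
Qed.

Lemma idl n f : tgt f = n -> Id n \oo f ~~~ f.
Proof.
move=> e; apply: teq_bmc => /=; first by move=> ->; rewrite e eqxx.
by move=> /andP[w _]; split=> //; apply: (@bmc_idl _ (src f)); rewrite -e; apply: wt_typed.
Qed.

Lemma idr n f : src f = n -> f \oo Id n ~~~ f.
Proof.
move=> e; apply: teq_bmc => /=; first by move=> ->; rewrite e eqxx.
by move=> /andP[w _]; split=> //; apply: (@bmc_idr _ _ (tgt f)); rewrite -e; apply: wt_typed.
Qed.

Lemma tensA f g h : (f ** g) ** h ~~~ f ** (g ** h).
Proof.
apply: teq_bmc => /=; first by rewrite andbA.
move=> /andP[/andP[wf wg] wh]; rewrite wf wg wh !addnA; split=> //.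
by apply: bmc_tassoc; apply: wt_typed.
Qed.

Lemma tens0l f : Id 0 ** f ~~~ f.
Proof.
apply: teq_bmc => //= w; split=> //.
by apply: bmc_tunitl; apply: wt_typed.
Qed.

Lemma tens0r f : f ** Id 0 ~~~ f.
Proof.
apply: teq_bmc => /= [->//|]; rewrite andbT !addn0 => w; split=> //.
by apply: bmc_tunitr; apply: wt_typed.
Qed.

Lemma tensid m n : Id m ** Id n ~~~ Id (m + n).
Proof. by apply: teq_bmc => //= _; split=> //; apply: bmc_tid. Qed.

(** The hypothesis aligns the cuts between tensor factors: a composite of tensors can be well typed
    with its cuts at different places. Once one pair matches, typing forces the other by
    cancellation in the sum. *)
Lemma comp_tens f f' g g' : tgt f' = src f ->
  (f ** g) \oo (f' ** g') ~~~ (f \oo f') ** (g \oo g').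
Proof.
move=> e; apply: teq_bmc => /=; rewrite e eqn_add2l eqxx.
  by case/andP=> /and3P[-> -> _] /and3P[-> -> ->].
case/and3P=> /andP[wf wg] /andP[wf' wg'] /eqP eg; rewrite wf wg wf' wg' eg eqxx.
split=> //; apply: bmc_interchange; try exact: wt_typed.
  by rewrite e; apply: wt_typed.
by rewrite eg; apply: wt_typed.
Qed.

Lemma br_nat f g :
  Br (tgt f) (tgt g) \oo (f ** g) ~~~ (g ** f) \oo Br (src f) (src g).
Proof.
apply: teq_bmc => /=; rewrite !eqxx !andbT; first by rewrite andbC.
move=> /andP[wf wg]; rewrite wf wg; split=> //.
by apply: bmc_nat; apply: wt_typed.
Qed.

Lemma hex1 l m n : Br l (m + n) ~~~ (Id m ** Br l n) \oo (Br l m ** Id n).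
Proof.
apply: teq_bmc => //= _; split; rewrite ?addnA ?eqxx //.
exact: bmc_hex1.
Qed.

Lemma hex2 l m n : Br (l + m) n ~~~ (Br l n ** Id m) \oo (Id l ** Br m n).
Proof.
apply: teq_bmc => //= _; split; rewrite ?addnA ?eqxx //.
exact: bmc_hex2.
Qed.

Lemma br_inv1 m n : Br m n \oo BrInv m n ~~~ Id (n + m).
Proof. by apply: teq_bmc => //= _; split; rewrite ?eqxx //; apply: bmc_inv1. Qed.

Lemma br_inv2 m n : BrInv m n \oo Br m n ~~~ Id (m + n).
Proof. by apply: teq_bmc => //= _; split; rewrite ?eqxx //; apply: bmc_inv2. Qed.

Ltac from_rel r := apply: teq_gen; [exact: r | exact/typedE | exact/typedE].

Lemma tau_invol : tau11 \oo tau11 ~~~ Id 2.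
Proof. from_rel (vcc_hopf (vh1 F)). Qed.
Lemma mu_assoc : mu \oo (mu ** Id 1) ~~~ mu \oo (Id 1 ** mu).
Proof. from_rel (vcc_hopf (vh2 F)). Qed.
Lemma mu_unl : mu \oo (un ** Id 1) ~~~ Id 1.
Proof. from_rel (vcc_hopf (vh3 F)). Qed.
Lemma mu_unr : mu \oo (Id 1 ** un) ~~~ Id 1.
Proof. from_rel (vcc_hopf (vh4 F)). Qed.
Lemma De_coassoc : (De ** Id 1) \oo De ~~~ (Id 1 ** De) \oo De.
Proof. from_rel (vcc_hopf (vh5 F)). Qed.
Lemma De_epl : (ep ** Id 1) \oo De ~~~ Id 1.
Proof. from_rel (vcc_hopf (vh6 F)). Qed.
Lemma De_epr : (Id 1 ** ep) \oo De ~~~ Id 1.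
Proof. from_rel (vcc_hopf (vh7 F)). Qed.
Lemma ep_un : ep \oo un ~~~ Id 0.
Proof. from_rel (vcc_hopf (vh8 F)). Qed.
Lemma ep_mu : ep \oo mu ~~~ ep ** ep.
Proof. from_rel (vcc_hopf (vh9 F)). Qed.
Lemma De_un : De \oo un ~~~ un ** un.
Proof. from_rel (vcc_hopf (vh10 F)). Qed.
Lemma De_mu : De \oo mu ~~~
  (mu ** mu) \oo ((Id 1 ** (tau11 ** Id 1)) \oo (De ** De)).
Proof. from_rel (vcc_hopf (vh11 F)). Qed.
Lemma antipodel : mu \oo ((Sg ** Id 1) \oo De) ~~~ un \oo ep.
Proof. from_rel (vcc_hopf (vh12 F)). Qed.
Lemma antipoder : mu \oo ((Id 1 ** Sg) \oo De) ~~~ un \oo ep.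
Proof. from_rel (vcc_hopf (vh13 F)). Qed.
Lemma De_cocomm : De ~~~ tau11 \oo De.
Proof. from_rel (vcc_cocomm F). Qed.
Lemma mu_comm : mu ~~~ mu \oo tau11.
Proof. from_rel (vcc_comm F). Qed.

(* A morphism is encoded as a list of layers [(a, g)]: [g] acts on the strands
   from position [a] on and the other strands go straight through.  The laws of
   a strict monoidal category become list computations, except for the exchange
   of consecutive layers that act on disjoint strands. *)
Definition layer w a g := Id a ** (g ** Id (w - a - src g)).

Fixpoint realize (w : nat) (D : seq (nat * tm)) : tm :=
  match D with
  | [::] => Id w
  | (a, g) :: D' => realize (w + tgt g - src g) D' \oo layer w a g
  end.

Fixpoint out_width (w : nat) (D : seq (nat * tm)) : nat :=
  match D with [::] => w | (a, g) :: D' => out_width (w + tgt g - src g) D' end.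

(** On lists that pass this test the truncated subtractions in [layer], [realize] and [out_width]
    are exact. *)
Fixpoint fits (w : nat) (D : seq (nat * tm)) : bool :=
  match D with
  | [::] => true
  | (a, g) :: D' => [&& wt g, a + src g <= w & fits (w + tgt g - src g) D']
  end.

Definition shift_layers (k : nat) (D : seq (nat * tm)) := [seq (k + p.1, p.2) | p <- D].

Lemma fits_realize w D : fits w D -> [/\ wt (realize w D), src (realize w D) = w & tgt (realize w D) = out_width w D].
Proof.
elim: D w => [|[a g] D IH] //= w /and3P[wg le /IH[w1 s1 t1]].
by rewrite w1 s1 wg /= t1; split=> //; [apply/eqP|]; lia.
Qed.

Lemma fits_cat w D1 D2 : fits w (D1 ++ D2) = fits w D1 && fits (out_width w D1) D2.
Proof. by elim: D1 w => [|[a g] D IH] //= w; rewrite IH !andbA. Qed.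

Lemma realize_cat w D1 D2 : fits w (D1 ++ D2) ->
  realize w (D1 ++ D2) ~~~ realize (out_width w D1) D2 \oo realize w D1.
Proof.
elim: D1 w => [|[a g] D IH] /= w.
  by case/fits_realize=> _ s _; rewrite idr.
by case/and3P=> wg le h; rewrite IH // cmpA.
Qed.

Lemma fits_shl k w D : fits w D -> fits (k + w) (shift_layers k D) /\ out_width (k + w) (shift_layers k D) = k + out_width w D.
Proof.
elim: D w => [|[a g] D IH] //= w /and3P[wg le h].
have e : k + w + tgt g - src g = k + (w + tgt g - src g) by lia.
by rewrite e wg; have [-> ->] := IH _ h; split=> //; lia.
Qed.

Lemma fits_shr k w D : fits w D -> fits (w + k) D /\ out_width (w + k) D = out_width w D + k.
Proof.
elim: D w => [|[a g] D IH] //= w /and3P[wg le h].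
have e : w + k + tgt g - src g = w + tgt g - src g + k by lia.
by rewrite e wg; have [-> ->] := IH _ h; split=> //; lia.
Qed.

Lemma realize_shl k w D : fits w D -> Id k ** realize w D ~~~ realize (k + w) (shift_layers k D).
Proof.
elim: D w => [|[a g] D IH] /= w; first by rewrite tensid.
case/and3P=> wg le h.
have e : k + w + tgt g - src g = k + (w + tgt g - src g) by lia.
rewrite e -IH // -[X in X ** _](@idl k (Id k)) // -comp_tens //=.
have -> : layer (k + w) (k + a) g ~~~ Id k ** layer w a g; last reflexivity.
by rewrite /layer -(tensA (Id k)) tensid; have -> : k + w - (k + a) - src g = w - a - src g by lia.
Qed.

Lemma realize_shr k w D : fits w D -> realize w D ** Id k ~~~ realize (w + k) D.
Proof.
elim: D w => [|[a g] D IH] /= w; first by rewrite tensid.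
case/and3P=> wg le h.
have e : w + k + tgt g - src g = w + tgt g - src g + k by lia.
rewrite e -IH // -[X in _ ** X](@idl k (Id k)) // -comp_tens /=; last first.
  by case/fits_realize: h => _ -> _; lia.
have -> : layer (w + k) a g ~~~ layer w a g ** Id k; last reflexivity.
by rewrite /layer !tensA tensid; have -> : w + k - a - src g = w - a - src g + k by lia.
Qed.

(** The guard [wt t] lets a term be turned into layers by syntax alone; typing is checked once,
    afterwards, in [teq_layers]. *)
Definition represents t D := wt t -> fits (src t) D /\ t ~~~ realize (src t) D.

Lemma represents_wd t D : wt t -> represents t D -> out_width (src t) D = tgt t.
Proof.
move=> w /(_ w)[o [_ /(_ w)[_ -> _]]].
by case/fits_realize: o.
Qed.

Lemma represents_id n : represents (Id n) [::].
Proof. by split. Qed.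

Lemma represents_atom t : represents t [:: (0, t)].
Proof.
move=> w /=; rewrite w add0n leqnn; split=> //.
by rewrite /layer subn0 subnn tens0r tens0l addnC addnK idl.
Qed.

Lemma represents_comp f g Df Dg : represents f Df -> represents g Dg -> represents (f \oo g) (Dg ++ Df).
Proof.
move=> rf rg /and3P[wf wg /eqP e].
have [okf ef] := rf wf; have [okg eg] := rg wg; have wdg := represents_wd wg rg.
have o : fits (src g) (Dg ++ Df) by rewrite fits_cat okg wdg e okf.
by split=> //=; rewrite realize_cat // wdg e -ef -eg.
Qed.

Lemma represents_tens f g Df Dg : represents f Df -> represents g Dg ->
  represents (f ** g) (Df ++ shift_layers (tgt f) Dg).
Proof.
move=> rf rg /andP[wf wg].
have [okf ef] := rf wf; have [okg eg] := rg wg; have wdf := represents_wd wf rf.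
have [o1 w1] := fits_shr (src g) okf; have [o2 w2] := fits_shl (tgt f) okg.
have o : fits (src f + src g) (Df ++ shift_layers (tgt f) Dg).
  by rewrite fits_cat o1 w1 wdf o2.
split=> //=; rewrite realize_cat // w1 wdf -realize_shl // -realize_shr // -ef -eg comp_tens //.
by rewrite idl // idr.
Qed.

Lemma realize_ctx w P Q Q' : fits w (P ++ Q) -> fits (out_width w P) Q' ->
  realize (out_width w P) Q ~~~ realize (out_width w P) Q' ->
  fits w (P ++ Q') /\ realize w (P ++ Q) ~~~ realize w (P ++ Q').
Proof.
move=> o o' e; have o2 : fits w (P ++ Q').
  by move: o; rewrite !fits_cat o' => /andP[-> _].
by split; rewrite ?realize_cat // e.
Qed.

Lemma layer_swap w a f b g :
  a + src f <= w -> a + tgt f <= b -> b + src g <= w + tgt f - src f ->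
  layer (w + tgt f - src f) b g \oo layer w a f ~~~
  layer (w + tgt g - src g) a f \oo layer w (b + src f - tgt f) g.
Proof.
move=> l1 l2 l3.
(* [c] counts the strands between [f] and [g], and [r] those to the right of [g]; with these names
   both sides become [Id a], [f], [Id c], [g], [Id r] side by side. *)
have [c ec] : exists c, b = a + (tgt f + c) by exists (b - a - tgt f); lia.
have [r er] : exists r, w = a + (src f + (c + (src g + r))).
  by exists (w - a - src f - c - src g); lia.
rewrite /layer; have -> : w + tgt f - src f - b - src g = r by lia.
have -> : w - a - src f = c + (src g + r) by lia.
have -> : w + tgt g - src g - a - src f = c + (tgt g + r) by lia.
have -> : w - (b + src f - tgt f) - src g = r by lia.
have -> : b + src f - tgt f = a + (src f + c) by lia.
rewrite ec -!tensid !tensA !comp_tens //= !idl //= ?idr //=; lia.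
Qed.

Definition layers_eq w D E := fits w D -> fits w E -> realize w D ~~~ realize w E.

Lemma layers_eq_refl w D : layers_eq w D D. Proof. by move=> _ _; apply: teq_refl. Qed.

Lemma layers_eq_sym w D E : layers_eq w D E -> layers_eq w E D.
Proof. by move=> h o o'; exact: teq_sym (h o' o). Qed.

Lemma teq_layers t t' D D' : represents t D -> represents t' D' -> wt t -> wt t' ->
  src t = src t' -> layers_eq (src t) D D' -> t ~~~ t'.
Proof.
move=> r r' w w' e h; have [o1 h1] := r w; have [o2 h2] := r' w'.
apply: teq_trans h1 (teq_trans (h _ _) _); rewrite ?e //; first by rewrite -e.
exact: teq_sym.
Qed.

(** Stated backwards, from the modified list to [D], so that applying it performs one rewriting step
    on the left-hand list. Since [g] now acts before [f], its position is corrected by the change of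
    width due to [f]. *)
Lemma layers_eq_swapr i w D E a f b g : let D2 := drop 2 (drop i D) in
  drop i D = (a, f) :: (b, g) :: D2 -> a + tgt f <= b ->
  layers_eq w (take i D ++ (b + src f - tgt f, g) :: (a, f) :: D2) E -> layers_eq w D E.
Proof.
move=> D2 eD le h oD oE; have := oD.
rewrite -{1 2}(cat_take_drop i D) eD fits_cat /=.
case/and4P=> oP wf l1 /and3P[wg l2 oQ].
set w' := out_width _ _ in l1 l2 oQ.
have e3 : w' + tgt g - src g + tgt f - src f = w' + tgt f - src f + tgt g - src g by lia.
have [|||o e] := @realize_ctx w (take i D) ((a, f) :: (b, g) :: D2)
  ((b + src f - tgt f, g) :: (a, f) :: D2).
- by rewrite -eD cat_take_drop.
- by rewrite /= -/w' wf wg e3 oQ andbT; apply/andP; split; lia.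
- by rewrite /= -/w' e3 !cmpA layer_swap.
by rewrite e; apply: h.
Qed.

Lemma layers_eq_swapl i w D E a f b g : let D2 := drop 2 (drop i D) in
  drop i D = (a, f) :: (b, g) :: D2 -> b + src g <= a ->
  layers_eq w (take i D ++ (b, g) :: (a + tgt g - src g, f) :: D2) E -> layers_eq w D E.
Proof.
move=> D2 eD le h oD oE; have := oD.
rewrite -{1 2}(cat_take_drop i D) eD fits_cat /=.
case/and4P=> oP wf l1 /and3P[wg l2 oQ].
set w' := out_width _ _ in l1 l2 oQ.
have e3 : w' + tgt g - src g + tgt f - src f = w' + tgt f - src f + tgt g - src g by lia.
have [|||o e] := @realize_ctx w (take i D) ((a, f) :: (b, g) :: D2)
  ((b, g) :: (a + tgt g - src g, f) :: D2).
- by rewrite -eD cat_take_drop.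
- by rewrite /= -/w' wf wg e3 oQ !andbT; apply/andP; split; lia.
- have := @layer_swap w' b g (a + tgt g - src g) f.
  have -> : a + tgt g - src g + src g - tgt g = a by lia.
  by rewrite /= -/w' e3 !cmpA => ->; try lia.
by rewrite e; apply: h.
Qed.

(** The law [L ~~~ R] is padded with [a] identity strands on the left and [r] on the right, then
    inserted between the layers before and after the block; equality of the targets of [L] and [R]
    keeps the later layers in place. *)
Lemma realize_rewrite i a L R DL DR w D :
  L ~~~ R -> represents L DL -> represents R DR -> wt L -> fits w D ->
  drop i D = shift_layers a DL ++ drop (size DL) (drop i D) -> a + src L <= out_width w (take i D) ->
  let D' := take i D ++ shift_layers a DR ++ drop (size DL) (drop i D) in
  fits w D' /\ realize w D ~~~ realize w D'.
Proof.
move=> e rL rR wL oD eD le /=.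
set w' := out_width _ _ in le; set D2 := drop (size DL) _ in eD *.
have [ww] := e; case/(_ wL) => es et _.
have wR : wt R by rewrite -ww.
have [oL eL] := rL wL; have [oR eR] := rR wR.
have hL := represents_wd wL rL; have hR := represents_wd wR rR.
have [r er] : exists r, w' = a + src L + r by exists (w' - a - src L); lia.
have [oL' wL'] := fits_shr r oL; have [oR' wR'] := fits_shr r oR.
have [oL1 wL1] := fits_shl a oL'; have [oR1 wR1] := fits_shl a oR'.
have eLR : realize (src L) DL ~~~ realize (src L) DR.
  by apply: teq_trans (teq_sym eL) (teq_trans e _); rewrite es.
rewrite -es in oR oR' wR' oR1 wR1.
have key : realize w' (shift_layers a DL) ~~~ realize w' (shift_layers a DR).
  by rewrite er -addnA -!realize_shl // -!realize_shr // eLR.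
have /and3P[oP _ o2] : [&& fits w (take i D), true & fits (a + (tgt L + r)) D2].
  by move: oD; rewrite -{1}(cat_take_drop i D) eD !fits_cat -/w' er -addnA oL1 wL1 wL' hL.
have o' : fits w (take i D ++ shift_layers a DR ++ D2).
  by rewrite fits_cat oP -/w' fits_cat er -addnA oR1 wR1 wR' es hR -et.
split=> //.
have tailE D1 : fits w (take i D ++ D1 ++ D2) ->
    realize w (take i D ++ D1 ++ D2) ~~~ realize (out_width w' D1) D2 \oo (realize w' D1 \oo realize w (take i D)).
  move=> o1; rewrite realize_cat // -cmpA -/w'.
  by move: o1; rewrite fits_cat -/w' => /andP[_ /realize_cat ->].
rewrite -{1}(cat_take_drop i D) eD !tailE // -?eD ?cat_take_drop // key.
by rewrite er -addnA wL1 wL' hL et wR1 wR' es hR.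
Qed.

Lemma layers_eq_rw i a L R DL DR w D E : L ~~~ R -> represents L DL -> represents R DR -> wt L ->
  drop i D = shift_layers a DL ++ drop (size DL) (drop i D) -> a + src L <= out_width w (take i D) ->
  layers_eq w (take i D ++ shift_layers a DR ++ drop (size DL) (drop i D)) E -> layers_eq w D E.
Proof.
move=> e rL rR wL eD le h oD oE.
have [o e'] := realize_rewrite e rL rR wL oD eD le.
by rewrite e'; apply: h.
Qed.

(** All first copies precede all second copies, so the second leg of each [De] must cross the first
    copies of the strands that follow it. *)
Fixpoint diag (m : nat) : tm :=
  match m with
  | 0 => Id 0
  | m'.+1 => (Id 1 ** (Br 1 m' ** Id m')) \oo (De ** diag m')
  end.

Fixpoint eps (m : nat) : tm :=
  match m with 0 => Id 0 | m'.+1 => ep ** eps m' end.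

Lemma src_eps m : src (eps m) = m. Proof. by elim: m => //= m ->. Qed.
Lemma tgt_eps m : tgt (eps m) = 0. Proof. by elim: m => //= m ->. Qed.
Lemma wt_eps m : wt (eps m). Proof. by elim: m. Qed.
Lemma src_diag m : src (diag m) = m. Proof. by elim: m => //= m ->. Qed.
Lemma tgt_diag m : tgt (diag m) = m + m. Proof. by case: m => [//|m] /=; lia. Qed.
Lemma wt_diag m : wt (diag m).
Proof. by elim: m => //= m ->; rewrite tgt_diag /= !addnA eqxx. Qed.

End Teq.
#[local] Hint Resolve teq_refl : core.

Arguments diag : simpl never.
Arguments eps : simpl never.
Definition arityE := (src_eps, tgt_eps, wt_eps, src_diag, tgt_diag, wt_diag).

(** * Cartesian structure *)

(* In a goal on lists of layers, [rw i a H] rewrites with [H] the block that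
   starts at layer [i] and strand [a]; [swr i] and [swl i] exchange layers [i]
   and [i + 1] when the later one acts to the right, respectively to the left,
   of the earlier one; [flip] exchanges the two sides. *)
Ltac represents_tac := lazymatch goal with
  | |- represents _ (Comp _ _) _ => eapply represents_comp; represents_tac
  | |- represents _ (Tens _ _) _ => eapply represents_tens; represents_tac
  | |- represents _ (Id _) _ => eapply represents_id
  | |- _ => eapply represents_atom
  end.
Ltac sz := rewrite /= ?arityE /=; lia.
Ltac wt_tac := rewrite /= ?arityE /=;
  repeat (apply/andP; split); first [done | apply/eqP; lia | lia].
Ltac list_tac := rewrite /= ?arityE /=;
  repeat first [reflexivity | lia | f_equal].
Ltac layers := eapply teq_layers; [represents_tac | represents_tac | wt_tac | wt_tac | sz | ];
  rewrite /= ?arityE /= ?addn0 ?add0n.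
Ltac rw i a H := eapply (layers_eq_rw (i := i) (a := a) H);
  [represents_tac | represents_tac | wt_tac | list_tac | sz | rewrite /= ?arityE /= ?addn0 ?add0n].
Ltac swr i := eapply (layers_eq_swapr (i := i));
  [list_tac | sz | rewrite /= ?arityE /= ?addn0 ?add0n].
Ltac swl i := eapply (layers_eq_swapl (i := i));
  [list_tac | sz | rewrite /= ?arityE /= ?addn0 ?add0n].
Ltac flip := apply: layers_eq_sym.
Ltac fin := lazymatch goal with |- layers_eq _ _ ?D ?E =>
  let e := fresh in (have e : D = E by list_tac); case: _ / e; exact: layers_eq_refl end.

Section Cart.
Variable F : fieldType.
Local Notation "t ~~~ t'" := (teq F t t') (at level 70).

(** A hexagon with two zero indices makes [Br 0 n] idempotent, and an invertible idempotent is the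
    identity. *)
Lemma br0n n : Br 0 n ~~~ Id n.
Proof.
have e : Br 0 n ~~~ Br 0 n \oo Br 0 n.
  by have := hex2 F 0 0 n; rewrite tens0r tens0l.
have i := br_inv1 F 0 n; rewrite addn0 in i.
have h : (Br 0 n \oo Br 0 n) \oo BrInv 0 n ~~~ Br 0 n by rewrite cmpA i idr //=; lia.
by apply: teq_trans (teq_sym h) _; rewrite -e i.
Qed.

Lemma brn0 n : Br n 0 ~~~ Id n.
Proof.
have e : Br n 0 ~~~ Br n 0 \oo Br n 0.
  by have := hex1 F n 0 0; rewrite tens0r tens0l.
have i := br_inv1 F n 0; rewrite add0n in i.
have h : (Br n 0 \oo Br n 0) \oo BrInv n 0 ~~~ Br n 0 by rewrite cmpA i idr //=; lia.
by apply: teq_trans (teq_sym h) _; rewrite -e i.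
Qed.

(** The hexagons cut the double crossing into crossings of single strands, where [tau_invol]
    applies; [br_sym] repeats this in the other index. *)
Lemma br1_sym n : Br n 1 \oo Br 1 n ~~~ Id (1 + n).
Proof.
elim: n => [|n IH]; first by rewrite br0n brn0 idl.
layers.
rw 0 0 (hex1 F 1 1 n). rw 2 0 (hex2 F 1 n 1).
rw 1 1 IH. rw 0 0 (tau_invol F).
fin.
Qed.

Lemma br_sym m n : Br n m \oo Br m n ~~~ Id (m + n).
Proof.
elim: m => [|m IH]; first by rewrite br0n brn0 idl.
layers.
rw 0 0 (hex2 F 1 m n). rw 2 0 (hex1 F n 1 m).
rw 1 0 (br1_sym n). rw 0 1 IH.
fin.
Qed.

Lemma brinvE m n : BrInv m n ~~~ Br n m.
Proof.
have h : (BrInv m n \oo Br m n) \oo Br n m ~~~ BrInv m n.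
  by rewrite cmpA br_sym idr.
by apply: teq_trans (teq_sym h) _; rewrite br_inv2 idl.
Qed.

Lemma diagS m : diag m.+1 = (Id 1 ** (Br 1 m ** Id m)) \oo (De ** diag m).
Proof. by []. Qed.

Lemma diag1 : diag 1 ~~~ De.
Proof. by rewrite diagS brn0 !tens0r tensid idl. Qed.

Lemma diag2 : diag 2 ~~~ (Id 1 ** (tau11 ** Id 1)) \oo (De ** De).
Proof. by rewrite diagS diag1. Qed.

Lemma epsS m : eps m.+1 = ep ** eps m. Proof. by []. Qed.

Lemma eps1 : eps 1 ~~~ ep.
Proof. by rewrite epsS tens0r. Qed.

Lemma eps_add m p : eps (m + p) ~~~ eps m ** eps p.
Proof.
elim: m => [|m IH]; first by rewrite tens0l.
by rewrite addSn !epsS IH tensA.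
Qed.

Lemma diag_add m p :
  diag (m + p) ~~~ (Id m ** (Br m p ** Id p)) \oo (diag m ** diag p).
Proof.
elim: m => [|m IH].
  by rewrite tens0l br0n tensid tens0l idl // tgt_diag.
rewrite addSn !diagS; layers.
rw 1 2 IH. rw 4 1 (hex1 F 1 m p). flip. rw 4 m.+1 (hex2 F 1 m p).
swr 2. swr 3. fin.
Qed.

Lemma diag_epr m : (Id m ** eps m) \oo diag m ~~~ Id m.
Proof.
elim: m => [|m IH]; first by rewrite tensid idl.
rewrite diagS epsS; layers.
rw 2 1 (teq_sym (br_nat F ep (Id m))). rw 3 1 (br0n m). swl 1.
rw 0 0 (De_epr F). rw 0 1 IH. fin.
Qed.

Lemma diag_epl m : (eps m ** Id m) \oo diag m ~~~ Id m.
Proof.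
elim: m => [|m IH]; first by rewrite tensid idl.
rewrite diagS epsS; layers.
swl 2. swl 1. rw 0 0 (De_epl F).
rw 1 0 (teq_sym (br_nat F (Id 1) (eps m))). rw 2 0 (brn0 1).
rw 0 1 IH. fin.
Qed.

Definition cart f := wt f ->
  (diag (tgt f) \oo f ~~~ (f ** f) \oo diag (src f)) /\ (eps (tgt f) \oo f ~~~ eps (src f)).

Lemma cart_id n : cart (Id n).
Proof. by move=> _ /=; rewrite tensid idl ?idr ?src_diag ?tgt_diag ?src_eps. Qed.

Lemma cart_comp f g : cart f -> cart g -> cart (f \oo g).
Proof.
move=> cf cg /and3P[wf wg /eqP e].
have [f1 f2] := cf wf; have [g1 g2] := cg wg; rewrite -e in f1 f2.
split=> /=; last by rewrite -cmpA f2 g2.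
by rewrite -cmpA f1 cmpA g1 -cmpA comp_tens.
Qed.

Lemma cart_tens f g : cart f -> cart g -> cart (f ** g).
Proof.
move=> cf cg /andP[wf wg].
have [f1 f2] := cf wf; have [g1 g2] := cg wg.
split=> /=; last by rewrite !eps_add comp_tens ?src_eps // f2 g2.
layers.
rw 2 0 (diag_add (tgt f) (tgt g)). swl 1.
rw 0 0 f1. rw 3 (tgt f + tgt f) g1.
swl 5. swr 2. rw 3 (tgt f) (br_nat F f g). swr 1. swr 2.
flip. rw 0 0 (diag_add (src f) (src g)). fin.
Qed.

Lemma cart_br m n : cart (Br m n).
Proof.
move=> _ /=; split.
  layers.
  rw 1 0 (diag_add n m). rw 0 0 (teq_sym (br_nat F (diag m) (diag n))).
   rw 2 0 (hex2 F m m (n + n)).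
  rw 2 m (hex1 F m n n). rw 4 0 (hex1 F m n n). rw 5 n (br_sym m n).
  flip. rw 0 0 (diag_add m n). swr 3. fin.
rewrite eps_add (eps_add m n).
have := br_nat F (eps m) (eps n); rewrite !arityE => <-.
by rewrite br0n idl //= !arityE.
Qed.

Lemma cart_teq f g : f ~~~ g -> cart f -> cart g.
Proof.
move=> e cf wg; have [ww h] := e.
have wf : wt f by rewrite ww.
have [es et _] := h wf; have := cf wf; rewrite es et.
by move: (src g) (tgt g) => s t; rewrite e.
Qed.

Lemma cart_brinv m n : cart (BrInv m n).
Proof. exact: cart_teq (teq_sym (brinvE m n)) (@cart_br n m). Qed.

Lemma cart_mu : cart mu.
Proof.
move=> _ /=; split; last by rewrite eps1 ep_mu epsS eps1.
by rewrite diag1 diag2 De_mu.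
Qed.

Lemma cart_un : cart un.
Proof.
move=> _ /=; split; last by rewrite eps1 ep_un.
by rewrite diag1 De_un idr.
Qed.

Lemma cart_ep : cart ep.
Proof.
move=> _ /=; split; last by rewrite eps1 idl.
rewrite diag1 idl //; layers.
flip. rw 0 0 (De_epl F). fin.
Qed.

(** By coassociativity the two middle legs can be taken from a single [De], and cocommutativity
    absorbs their crossing. *)
Lemma De_exchange :
  (Id 1 ** (tau11 ** Id 1)) \oo ((De ** De) \oo De) ~~~ (De ** De) \oo De.
Proof.
layers.
flip. swr 1. rw 0 0 (teq_sym (De_coassoc F)). rw 1 0 (De_coassoc F).
rw 2 1 (De_cocomm F). flip.
swr 1. rw 0 0 (teq_sym (De_coassoc F)). rw 1 0 (De_coassoc F).
fin.
Qed.

Lemma cart_De : cart De.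
Proof.
move=> _ /=; split; first by rewrite diag1 diag2 cmpA De_exchange.
by rewrite (epsS 1) eps1; layers; rw 0 0 (De_epl F); fin.
Qed.

(** The product of the tensor square algebra. With the unit [un2] it makes [Hom(1, 2)] a convolution
    monoid, where [De] gets a left and a right inverse. *)
Definition mu2 : tm := (mu ** mu) \oo (Id 1 ** (tau11 ** Id 1)).
Definition un2 : tm := un ** un.
Definition conv2 f g : tm := mu2 \oo ((f ** g) \oo De).

#[local] Instance conv2_proper : Proper (teq F ==> teq F ==> teq F) conv2.
Proof. by move=> f f' ef g g' eg; rewrite /conv2 ef eg. Qed.

Lemma mu2_assoc : mu2 \oo (mu2 ** Id 2) ~~~ mu2 \oo (Id 2 ** mu2).
Proof.
rewrite /mu2; layers.
rw 2 1 (br_nat F mu (Id 1)). rw 2 1 (hex2 F 1 1 1).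
swr 1. swr 2. swl 4. rw 3 0 (mu_assoc F). rw 5 1 (mu_assoc F).
flip. swl 2. rw 1 1 (br_nat F (Id 1) mu). rw 1 1 (hex1 F 1 1 1).
swl 4. swl 0. fin.
Qed.

Lemma mu2_unr : mu2 \oo (Id 2 ** un2) ~~~ Id 2.
Proof.
rewrite /mu2 /un2; layers.
swl 1. rw 0 1 (br_nat F (Id 1) un). rw 0 1 (brn0 1).
swl 1. rw 0 0 (mu_unr F). rw 0 1 (mu_unr F). fin.
Qed.

Lemma mu2_unl : mu2 \oo (un2 ** Id 2) ~~~ Id 2.
Proof.
rewrite /mu2 /un2; layers.
rw 1 1 (br_nat F un (Id 1)). rw 1 1 (br0n 1).
swl 1. rw 0 0 (mu_unl F). rw 0 1 (mu_unl F). fin.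
Qed.

Lemma mu2_De : mu2 \oo (De ** De) ~~~ De \oo mu.
Proof. by rewrite De_mu cmpA. Qed.

Lemma conv2_assoc f g h : wt f -> wt g -> wt h ->
  src f = 1 -> src g = 1 -> src h = 1 -> tgt f = 2 -> tgt g = 2 -> tgt h = 2 ->
  conv2 (conv2 f g) h ~~~ conv2 f (conv2 g h).
Proof.
move=> wf wg wh sf sg shift_layers tf tg th; rewrite /conv2; layers.
rewrite tf.
swr 4. rw 5 0 mu2_assoc. rw 0 0 (De_coassoc F).
flip. swr 1. fin.
Qed.

Lemma conv2_unr f : wt f -> src f = 1 -> tgt f = 2 -> conv2 f (un2 \oo ep) ~~~ f.
Proof.
move=> wf sf tf; rewrite /conv2; layers.
rewrite tf. swr 1. rw 0 0 (De_epr F). rw 1 0 mu2_unr. fin.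
Qed.

Lemma conv2_unl f : wt f -> src f = 1 -> tgt f = 2 -> conv2 (un2 \oo ep) f ~~~ f.
Proof.
move=> wf sf tf; rewrite /conv2; layers.
rw 0 0 (De_epl F). swr 0. rw 1 0 mu2_unl. fin.
Qed.

Lemma conv2_DeS_De : conv2 (De \oo Sg) De ~~~ un2 \oo ep.
Proof.
rewrite /conv2 /un2; layers.
rw 2 0 mu2_De. rw 0 0 (antipodel F). rw 1 0 (De_un F). fin.
Qed.

(** In functional notation the left side is [x_(1) S x_(3)] tensor [x_(2) S x_(4)]. Exchanging the
    middle legs, which is the use of cocommutativity, gives [x_(1) S x_(2)] tensor [x_(3) S x_(4)],
    and the antipode law applies in each factor. *)
Lemma conv2_De_SSDe : conv2 De ((Sg ** Sg) \oo De) ~~~ un2 \oo ep.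
Proof.
rewrite /conv2 /un2 /mu2; layers.
swl 4. rw 3 1 (br_nat F (Id 1) Sg). rw 0 0 De_exchange.
swl 4. swl 2. swl 3. rw 1 0 (antipoder F). rw 3 1 (antipoder F).
rw 0 0 (De_epl F). swr 0. fin.
Qed.

Lemma cart_S : cart Sg.
Proof.
move=> _ /=; split; last first.
  rewrite eps1; layers.
  (* The counit of [S x] is that of [S x_(1)] times that of [x_(2)], hence that of the product
     [S x_(1) x_(2)], which the antipode law evaluates. *)
  rw 0 0 (teq_sym (De_epr F)). swl 1. swl 2. rw 2 0 (teq_sym (ep_mu F)).
  rw 0 0 (antipodel F). rw 1 0 (ep_un F). fin.
(* A left inverse equals a right inverse: the unit is expanded as [De] times its right inverse,
   reassociated, and cancelled against the left inverse [De \oo Sg]. *)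
rewrite diag1 -[X in X ~~~ _]conv2_unr // -conv2_De_SSDe -conv2_assoc //.
by rewrite conv2_DeS_De conv2_unl.
Qed.

Lemma cart_all f : cart f.
Proof.
elim: f => [n|m n|m n|[]|f IHf g IHg|f IHf g IHg].
- exact: cart_id.
- exact: cart_br.
- exact: cart_brinv.
- exact: cart_mu.
- exact: cart_un.
- exact: cart_De.
- exact: cart_ep.
- exact: cart_S.
- exact: cart_comp.
- exact: cart_tens.
Qed.

Lemma diag_nat f : wt f -> diag (tgt f) \oo f ~~~ (f ** f) \oo diag (src f).
Proof. by case/cart_all. Qed.

Lemma eps_nat f : wt f -> eps (tgt f) \oo f ~~~ eps (src f).
Proof. by case/cart_all. Qed.

(** Pairing the two projections gives the identity. With naturality of [diag] this recovers a
    morphism from its projections, the uniqueness half of the product property. *)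
Lemma diag_split a b :
  ((Id a ** eps b) ** (eps a ** Id b)) \oo diag (a + b) ~~~ Id (a + b).
Proof.
layers.
rw 0 0 (diag_add a b).
rw 2 a (teq_sym (br_nat F (eps a) (eps b))). rw 4 a (brn0 0).
swl 1. rw 0 0 (diag_epr a). rw 0 a (diag_epl b). fin.
Qed.

Lemma pair_proj a b f : wt f -> tgt f = a + b ->
  f ~~~ ((Id a ** eps b \oo f) ** (eps a ** Id b \oo f)) \oo diag (src f).
Proof.
move=> wf tf; rewrite -comp_tens ?cmpA; last by rewrite /= src_eps.
by rewrite -diag_nat // tf -cmpA diag_split idl.
Qed.

Lemma jointly_monic2 a b f g : wt f -> wt g -> src f = src g ->
  tgt f = a + b -> tgt g = a + b ->
  (Id a ** eps b) \oo f ~~~ (Id a ** eps b) \oo g ->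
  (eps a ** Id b) \oo f ~~~ (eps a ** Id b) \oo g -> f ~~~ g.
Proof.
move=> wf wg es tf tg e1 e2.
by rewrite (pair_proj wf tf) (pair_proj wg tg) e1 e2 es.
Qed.

Definition pr n k : tm := eps k ** (Id 1 ** eps (n - k.+1)).

Lemma prS n k : k < n -> pr n k \oo (eps 1 ** Id n) ~~~ pr n.+1 k.+1.
Proof.
move=> lt; rewrite /pr; layers.
flip. rw 0 0 (eps_add 1 k). fin.
Qed.

Lemma jointly_monic n f g : wt f -> wt g -> src f = src g ->
  tgt f = n -> tgt g = n ->
  (forall k, k < n -> pr n k \oo f ~~~ pr n k \oo g) -> f ~~~ g.
Proof.
elim: n f g => [|n IH] f g wf wg es tf tg h.
  (* The object 0 is terminal: naturality of [eps] forces both morphisms to be [eps]. *)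
  have := eps_nat wf; have := eps_nat wg.
  by rewrite tf tg es !idl // => eg ef; apply: teq_trans ef (teq_sym eg).
apply: (@jointly_monic2 1 n) => //.
  by have := h 0 isT; rewrite /pr tens0l subn1.
apply: IH => /=; rewrite ?arityE ?wf ?wg ?tf ?tg ?eqxx // => k lt.
by rewrite -!cmpA prS // h.
Qed.

End Cart.

(** * The convolution group of morphisms to 1 *)

Section Hom.
Variable F : fieldType.
Local Notation "t ~~~ t'" := (teq F t t') (at level 70).

Lemma eps_diag m : eps (m + m) \oo diag m ~~~ eps m.
Proof. by have := eps_nat F (wt_diag m); rewrite !arityE. Qed.

(** Compared after projection to the first [m] and the last [m + m] strands, which avoids unfolding
    the recursion of [diag]; [diag_cocomm] is handled alike. *)
Lemma diag_coassoc m : (diag m ** Id m) \oo diag m ~~~ (Id m ** diag m) \oo diag m.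
Proof.
apply: (@jointly_monic2 F m (m + m)) => //=; rewrite ?arityE ?eqxx //=; try lia.
  layers. rw 2 m (eps_add F m m). rw 1 0 (diag_epr F m). rw 0 0 (diag_epr F m).
  flip. rw 1 m (eps_diag m). rw 0 0 (diag_epr F m). fin.
layers. rw 1 0 (diag_epl F m).
flip. swl 1. rw 0 0 (diag_epl F m). fin.
Qed.

Lemma diag_cocomm m : Br m m \oo diag m ~~~ diag m.
Proof.
apply: (@jointly_monic2 F m m) => //=; rewrite ?arityE ?eqxx //=.
  layers. rw 1 0 (teq_sym (br_nat F (eps m) (Id m))). rw 2 0 (br0n F m).
  rw 0 0 (diag_epl F m). flip. rw 0 0 (diag_epr F m). fin.
layers. rw 1 0 (teq_sym (br_nat F (Id m) (eps m))). rw 2 0 (brn0 F m).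
rw 0 0 (diag_epr F m). flip. rw 0 0 (diag_epl F m). fin.
Qed.

Definition hom1 m f := [&& wt f, src f == m & tgt f == 1].
Definition conv m f g : tm := mu \oo ((f ** g) \oo diag m).
Definition unit_hom m : tm := un \oo eps m.

#[local] Instance conv_proper m : Proper (teq F ==> teq F ==> teq F) (conv m).
Proof. by move=> f f' ef g g' eg; rewrite /conv ef eg. Qed.

Lemma hom_conv m f g : hom1 m f -> hom1 m g -> hom1 m (conv m f g).
Proof.
move=> /and3P[wf /eqP sf /eqP tf] /and3P[wg /eqP sg /eqP tg].
by rewrite /hom1 /= !arityE wf wg sf sg tf tg !eqxx.
Qed.

Lemma hom_unit m : hom1 m (unit_hom m).
Proof. by rewrite /hom1 /= !arityE !eqxx. Qed.

Lemma hom_S m f : hom1 m f -> hom1 m (Sg \oo f).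
Proof. by move=> /and3P[wf sf tf]; rewrite /hom1 /= wf sf tf. Qed.

Lemma conv_assoc m f g h : hom1 m f -> hom1 m g -> hom1 m h ->
  conv m (conv m f g) h ~~~ conv m f (conv m g h).
Proof.
move=> /and3P[wf /eqP sf /eqP tf] /and3P[wg /eqP sg /eqP tg] /and3P[wh /eqP s_h /eqP th].
rewrite /conv; layers. rewrite tf ?tg.
rw 0 0 (diag_coassoc m). swr 4. rw 5 0 (mu_assoc F).
flip. swr 1. fin.
Qed.

(** The crossing created by commutativity of [mu] slides past [f] and [g] and is absorbed by
    cocommutativity of [diag]. *)
Lemma conv_comm m f g : hom1 m f -> hom1 m g -> conv m f g ~~~ conv m g f.
Proof.
move=> /and3P[wf /eqP sf /eqP tf] /and3P[wg /eqP sg /eqP tg].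
have e := br_nat F f g; rewrite tf tg sf sg in e.
rewrite /conv; layers. rewrite tf tg.
rw 3 0 (mu_comm F). rw 1 0 e. rw 0 0 (diag_cocomm m). fin.
Qed.

Lemma conv_unitl m f : hom1 m f -> conv m (unit_hom m) f ~~~ f.
Proof.
move=> /and3P[wf /eqP sf /eqP tf]; rewrite /conv /unit_hom; layers.
rw 0 0 (diag_epl F m). swr 0. rw 1 0 (mu_unl F). fin.
Qed.

Lemma conv_unitr m f : hom1 m f -> conv m f (unit_hom m) ~~~ f.
Proof. by move=> h; rewrite conv_comm ?conv_unitl ?hom_unit. Qed.

Lemma conv_Sl m f : hom1 m f -> conv m (Sg \oo f) f ~~~ unit_hom m.
Proof.
move=> /and3P[wf /eqP sf /eqP tf]; rewrite /conv /unit_hom; layers.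
have e := diag_nat F wf; rewrite tf sf diag1 in e.
have e' := eps_nat F wf; rewrite tf sf eps1 in e'.
swr 2. rw 0 0 (teq_sym e). rw 1 0 (antipodel F). rw 0 0 e'. fin.
Qed.

(** Naturality of [diag] for an arbitrary [h] makes precomposition a homomorphism of convolution
    groups; this is how linear form is transported along composition. *)
Lemma conv_compr m n f g h : wt h -> src h = m -> tgt h = n -> hom1 n f -> hom1 n g ->
  conv n f g \oo h ~~~ conv m (f \oo h) (g \oo h).
Proof.
move=> wh s_h th /and3P[wf /eqP sf /eqP tf] /and3P[wg /eqP sg /eqP tg].
have e := diag_nat F wh; rewrite th s_h in e.
by rewrite /conv !cmpA e -(cmpA _ (f ** g)) comp_tens // th.
Qed.

Lemma unit_compr m n h : wt h -> src h = m -> tgt h = n ->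
  unit_hom n \oo h ~~~ unit_hom m.
Proof. by move=> wh <- <-; rewrite /unit_hom cmpA eps_nat. Qed.

Lemma conv_ACA m a b c d : hom1 m a -> hom1 m b -> hom1 m c -> hom1 m d ->
  conv m (conv m a b) (conv m c d) ~~~ conv m (conv m a c) (conv m b d).
Proof.
move=> ha hb hc hd.
rewrite (conv_assoc ha hb) ?hom_conv // -(conv_assoc hb hc hd) (conv_comm hb hc).
by rewrite (conv_assoc hc hb hd) -(conv_assoc ha hc) // hom_conv.
Qed.

Lemma conv_inv_uniq m f g : hom1 m f -> hom1 m g -> conv m f g ~~~ unit_hom m ->
  Sg \oo f ~~~ g.
Proof.
move=> hf hg e; have hS := hom_S hf.
by rewrite -(conv_unitr hS) -e -(conv_assoc hS hf hg) conv_Sl // conv_unitl.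
Qed.

Definition zpow m (z : int) g : tm :=
  match z with
  | Posz k => iter k (conv m g) (unit_hom m)
  | Negz k => iter k.+1 (conv m (Sg \oo g)) (unit_hom m)
  end.

Lemma hom_zpow m z g : hom1 m g -> hom1 m (zpow m z g).
Proof.
move=> hg; have hi k f : hom1 m f -> hom1 m (iter k (conv m f) (unit_hom m)).
  by move=> hf; elim: k => [|k IH] /=; rewrite ?hom_unit // hom_conv.
by case: z => k; apply: hi => //; apply: hom_S.
Qed.

Lemma zpow_succ m z g : hom1 m g -> zpow m (z + 1)%R g ~~~ conv m g (zpow m z g).
Proof.
move=> hg; case: z => [k|k].
  by have -> : (Posz k + 1 = Posz k.+1)%R by lia.
have hS := hom_S hg; case: k => [|k].
  have -> : (Negz 0 + 1 = 0)%R by lia.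
  rewrite /= -conv_assoc ?hom_unit // (conv_comm hg) // conv_Sl //.
  by rewrite conv_unitl ?hom_unit.
have -> : (Negz k.+1 + 1 = Negz k)%R by lia.
have hk := hom_zpow (Negz k) hg; rewrite /= in hk *.
by rewrite -(conv_assoc hg) // (conv_comm hg) // conv_Sl // conv_unitl.
Qed.

Lemma zpow_pred m z g : hom1 m g ->
  zpow m (z - 1)%R g ~~~ conv m (Sg \oo g) (zpow m z g).
Proof.
move=> hg; have hS := hom_S hg; have hz := hom_zpow (z - 1)%R hg.
rewrite -{2}(subrK 1%R z) zpow_succ // -conv_assoc // conv_Sl //.
by rewrite conv_unitl.
Qed.

Lemma zpow_add m x y g : hom1 m g ->
  zpow m (x + y)%R g ~~~ conv m (zpow m x g) (zpow m y g).
Proof.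
move=> hg; have hy := hom_zpow y hg; have hS := hom_S hg.
elim/int_rec: x => [|n IH|n IH].
- by rewrite add0r conv_unitl.
- have -> : (Posz n.+1 + y = Posz n + y + 1)%R by lia.
  have -> : (Posz n.+1 = Posz n + 1)%R by lia.
  by rewrite !zpow_succ // IH conv_assoc // hom_zpow.
- have -> : (- Posz n.+1 + y = - Posz n + y - 1)%R by lia.
  have -> : (- Posz n.+1 = - Posz n - 1)%R by lia.
  by rewrite !zpow_pred // IH conv_assoc // hom_zpow.
Qed.

Lemma src_pr n k : k < n -> src (pr n k) = n.
Proof. by move=> lt; rewrite /= !arityE; lia. Qed.
Lemma tgt_pr n k : tgt (pr n k) = 1. Proof. by rewrite /= !arityE. Qed.
Lemma wt_pr n k : wt (pr n k). Proof. by rewrite /= !arityE. Qed.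

Lemma hom_pr n k : k < n -> hom1 n (pr n k).
Proof. by move=> lt; rewrite /hom1 wt_pr src_pr // tgt_pr !eqxx. Qed.

(** The index list is kept general for induction, and the coefficients form a function on [nat] to
    avoid ordinals; the list of interest is [iota 0 m]. *)
Definition lin m (l : seq nat) (a : nat -> int) : tm :=
  foldr (fun i acc => conv m (zpow m (a i) (pr m i)) acc) (unit_hom m) l.

Lemma hom_lin m l a : all (fun i => i < m) l -> hom1 m (lin m l a).
Proof.
elim: l => [|i l IH] /=; first by rewrite hom_unit.
by case/andP=> lt al; rewrite hom_conv ?IH ?hom_zpow ?hom_pr.
Qed.

Lemma lin_add m l a b : all (fun i => i < m) l ->
  conv m (lin m l a) (lin m l b) ~~~ lin m l (fun i => a i + b i)%R.
Proof.
elim: l => [|i l IH] /=; first by rewrite conv_unitl ?hom_unit.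
case/andP=> lt al; have hp := hom_pr lt.
by rewrite conv_ACA ?hom_lin ?hom_zpow // IH // -zpow_add.
Qed.

Lemma lin0 m l a : all (fun i => i < m) l -> {in l, forall i, a i = 0%R} ->
  lin m l a ~~~ unit_hom m.
Proof.
elim: l => //= i l IH /andP[lt al] h.
rewrite h ?mem_head // IH ?conv_unitl ?hom_unit // => j jl.
by rewrite h // inE jl orbT.
Qed.

(** Distributing [Sg] over products is avoided: the combination with opposite coefficients is a
    convolution inverse, and inverses are unique. *)
Lemma lin_opp m l a : all (fun i => i < m) l ->
  Sg \oo lin m l a ~~~ lin m l (fun i => - a i)%R.
Proof.
move=> al; apply: (@conv_inv_uniq m); rewrite ?hom_lin // lin_add //.
by apply: lin0 => // i _; rewrite subrr.
Qed.

Lemma lin_pr m l i : all (fun i => i < m) l -> uniq l -> i \in l ->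
  lin m l (fun j => (j == i)%:R)%R ~~~ pr m i.
Proof.
elim: l => //= j l IH /andP[lt al] /andP[jl ul].
rewrite inE eq_sym; have [<- _|ne /= il] := eqVneq j i.
  have -> : zpow m true%:R%R (pr m j) = conv m (pr m j) (unit_hom m) by [].
  rewrite lin0 // => [|k kl]; first by rewrite !conv_unitr ?hom_conv ?hom_unit ?hom_pr //.
  by have [e|] := eqVneq k j; rewrite // -e kl in jl.
by rewrite conv_unitl ?IH // hom_lin.
Qed.

Definition spanned m f := exists a, f ~~~ lin m (iota 0 m) a.

Lemma all_iota0 m : all (fun i => i < m) (iota 0 m).
Proof. by apply/allP => i; rewrite mem_iota. Qed.
#[local] Hint Resolve all_iota0 : core.

Lemma spanned_teq m f g : f ~~~ g -> spanned m g -> spanned m f.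
Proof. by move=> e [a h]; exists a; rewrite e. Qed.

Lemma spanned_conv m f g : spanned m f -> spanned m g -> spanned m (conv m f g).
Proof.
by move=> [a ef] [b eg]; exists (fun i => a i + b i)%R; rewrite ef eg lin_add.
Qed.

Lemma spanned_S m f : spanned m f -> spanned m (Sg \oo f).
Proof. by move=> [a ef]; exists (fun i => - a i)%R; rewrite ef lin_opp. Qed.

Lemma spanned_unit m : spanned m (unit_hom m).
Proof. by exists (fun=> 0%R); rewrite lin0. Qed.

Lemma spanned_pr m i : i < m -> spanned m (pr m i).
Proof.
by move=> lt; exists (fun j => (j == i)%:R)%R; rewrite lin_pr ?iota_uniq ?mem_iota.
Qed.

(** Precomposition with [h] turns a combination of coordinates of [n] into the same combination of
    the projections of [h], each of which is spanned. The resulting coefficients, a matrix product,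
    are never computed. *)
Lemma spanned_comp m n f h : spanned n f -> wt h -> src h = m -> tgt h = n ->
  (forall k, k < n -> spanned m (pr n k \oo h)) -> spanned m (f \oo h).
Proof.
move=> [a ef] wh s_h th hk; have ef' : f \oo h ~~~ lin n (iota 0 n) a \oo h by rewrite ef.
apply: spanned_teq ef' _; have := all_iota0 n.
have su : spanned m (unit_hom n \oo h).
  by apply: spanned_teq (spanned_unit m); rewrite unit_compr.
have sconv f1 f2 : hom1 n f1 -> hom1 n f2 -> spanned m (f1 \oo h) -> spanned m (f2 \oo h) ->
    spanned m (conv n f1 f2 \oo h).
  by move=> h1 h2 s1 s2; apply: spanned_teq (conv_compr wh s_h th h1 h2) (spanned_conv s1 s2).
have siter k f1 : hom1 n f1 -> spanned m (f1 \oo h) ->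
    spanned m (iter k (conv n f1) (unit_hom n) \oo h).
  move=> h1 s1; elim: k => //= k IH; apply: sconv => //.
  by elim: k {IH} => [|k IH] /=; rewrite ?hom_unit // hom_conv.
elim: (iota 0 n) => //= i l IH /andP[lt al].
have hp := hom_pr lt; apply: sconv; rewrite ?hom_lin ?hom_zpow //; last exact: IH.
case: (a i) => k; rewrite /zpow; apply: siter; rewrite ?hom_S //; first exact: hk.
by apply: spanned_teq (cmpA F _ _ _) _; apply: spanned_S; apply: hk.
Qed.

Lemma pr_addl a b k : k < a -> pr (a + b) k ~~~ pr a k ** eps b.
Proof.
move=> lt; rewrite /pr; have -> : a + b - k.+1 = a - k.+1 + b by lia.
by rewrite eps_add !tensA.
Qed.

Lemma pr_addr a b k : pr (a + b) (a + k) ~~~ eps a ** pr b k.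
Proof.
rewrite /pr; have -> : a + b - (a + k).+1 = b - k.+1 by lia.
by rewrite eps_add !tensA.
Qed.

Definition all_spanned f :=
  forall k, k < tgt f -> spanned (src f) (pr (tgt f) k \oo f).

Lemma ltn_addP a b k : k < a + b -> k < a \/ exists2 j, j < b & k = a + j.
Proof.
move=> lt; have [la|la] := ltnP k a; [by left|right].
by exists (k - a); lia.
Qed.

Lemma all_spanned_id n : all_spanned (Id n).
Proof.
move=> k /= lt; apply: spanned_teq (spanned_pr lt).
by rewrite idr // src_pr.
Qed.

Lemma all_spanned_br m n : all_spanned (Br m n).
Proof.
move=> k /= /ltn_addP[lt|[j lt ->]].
  (* Naturality of the braiding for a counit and a projection: the crossing left over is [Br 0 1],
     which is trivial. *)
  have := br_nat F (eps m) (pr n k); rewrite src_pr // tgt_pr !arityE br0n => e.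
  apply: spanned_teq (spanned_pr (_ : m + k < m + n)); last by rewrite ltn_add2l.
  by rewrite pr_addl // pr_addr -e idl //= !arityE.
have := br_nat F (pr m j) (eps n); rewrite src_pr // tgt_pr !arityE brn0 => e.
apply: spanned_teq (spanned_pr (_ : j < m + n)); last by rewrite ltn_addr.
by rewrite pr_addr (pr_addl n lt) -e idl //= !arityE.
Qed.

Lemma all_spanned_teq f g : f ~~~ g -> wt f -> all_spanned g -> all_spanned f.
Proof.
move=> e w; have [_ /(_ w)[es et _]] := e; rewrite /all_spanned es et => h k lt.
by apply: spanned_teq (h k lt); move: (tgt g) => t; rewrite e.
Qed.

Lemma all_spanned_comp f g : wt (f \oo g) -> all_spanned f -> all_spanned g ->
  all_spanned (f \oo g).
Proof.
move=> /and3P[wf wg /eqP e] hf hg k /= lt.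
apply: spanned_teq (teq_sym (cmpA F _ _ _)) _.
by apply: (spanned_comp (hf k lt) _ _ e _) => // j lj; rewrite -e; apply: hg; rewrite e.
Qed.

(** A projection of a tensor product sees one factor only, so it is a projection of that factor
    composed with the projection of the inputs onto its source; [spanned_comp] then applies. *)
Lemma all_spanned_tens f g : wt (f ** g) -> all_spanned f -> all_spanned g ->
  all_spanned (f ** g).
Proof.
move=> /= /andP[wf wg] hf hg k /= /ltn_addP[lt|[j lt ->]].
  have e : pr (tgt f + tgt g) k \oo (f ** g) ~~~
           (pr (tgt f) k \oo f) \oo (Id (src f) ** eps (src g)).
    rewrite pr_addl // comp_tens ?src_pr // eps_nat //.
    rewrite -[X in _ ~~~ X \oo _]tens0r comp_tens //= idl ?arityE // idr //.
  apply: spanned_teq e _; apply: spanned_comp (hf k lt) _ _ _ _ => /=; rewrite ?arityE ?addn0 //.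
  move=> i li; apply: spanned_teq (spanned_pr (_ : i < src f + src g)); last by rewrite ltn_addr.
  have := @comp_tens F (pr (src f) i) (Id (src f)) (Id 0) (eps (src g)) (esym (src_pr li)).
  rewrite tens0r => ->.
  by rewrite pr_addl // idr ?src_pr // idl ?arityE.
have e : pr (tgt f + tgt g) (tgt f + j) \oo (f ** g) ~~~
         (pr (tgt g) j \oo g) \oo (eps (src f) ** Id (src g)).
  rewrite pr_addr comp_tens ?arityE // eps_nat //.
  rewrite -[X in _ ~~~ X \oo _]tens0l comp_tens //= ?arityE // idl ?arityE // idr //.
apply: spanned_teq e _; apply: spanned_comp (hg j lt) _ _ _ _ => /=; rewrite ?arityE //.
move=> i li; apply: spanned_teq (spanned_pr (_ : src f + i < src f + src g)); last by rewrite ltn_add2l.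
have := @comp_tens F (Id 0) (eps (src f)) (pr (src g) i) (Id (src g)) (tgt_eps _).
rewrite tens0l => ->.
by rewrite pr_addr idl ?arityE // idr // src_pr.
Qed.

Lemma pr10 : pr 1 0 ~~~ Id 1.
Proof. by rewrite /pr tens0l tens0r. Qed.
Lemma pr20 : pr 2 0 ~~~ Id 1 ** eps 1.
Proof. by rewrite /pr tens0l. Qed.
Lemma pr21 : pr 2 1 ~~~ eps 1 ** Id 1.
Proof. by rewrite /pr tens0r. Qed.

Lemma all_spanned_all f : wt f -> all_spanned f.
Proof.
elim: f => [n|m n|m n|g|f IHf g IHg|f IHf g IHg] w.
- exact: all_spanned_id.
- exact: all_spanned_br.
- by apply: all_spanned_teq (brinvE F m n) _ (@all_spanned_br n m).
(* The product is the convolution of two coordinates, the unit is the neutral element, both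
   projections of [De] are the coordinate, and the antipode gives its inverse; [ep] has no
   projections. *)
- case: g w => _ k /=; case: k => [|[|k]] //= _.
  + apply: spanned_teq (spanned_conv (spanned_pr (isT : 0 < 2)) (spanned_pr (isT : 1 < 2))).
    by rewrite pr10 idl // /conv pr20 pr21 (diag_split F 1 1) idr.
  + by apply: spanned_teq (spanned_unit 0); rewrite pr10 idl // /unit_hom idr.
  + apply: spanned_teq (spanned_pr (isT : 0 < 1)).
    by rewrite pr20 eps1 (De_epr F) pr10.
  + apply: spanned_teq (spanned_pr (isT : 0 < 1)).
    by rewrite pr21 eps1 (De_epl F) pr10.
  + apply: spanned_teq (spanned_S (spanned_pr (isT : 0 < 1))).
    by rewrite pr10 idl // idr.
- by have /and3P[wf wg _] := w; apply: all_spanned_comp w (IHf wf) (IHg wg).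
- by have /andP[wf wg] := w; apply: all_spanned_tens w (IHf wf) (IHg wg).
Qed.
End Hom.

(** * Evaluation in the group Hopf algebra *)

Lemma eval_tens f g x1 x2 : size x1 = src f ->
  eval (Tens f g) (x1 ++ x2) = eval f x1 ++ eval g x2.
Proof. by move=> h; rewrite /= -h take_size_cat ?drop_size_cat. Qed.

Lemma eval_br m n x1 x2 : size x1 = m -> eval (Br m n) (x1 ++ x2) = x2 ++ x1.
Proof. by move=> h; rewrite /= -h take_size_cat ?drop_size_cat. Qed.

Lemma eval_brinv m n x1 x2 : size x1 = n -> eval (BrInv m n) (x1 ++ x2) = x2 ++ x1.
Proof. by move=> h; rewrite /= -h take_size_cat ?drop_size_cat. Qed.

Lemma size_split (T : Type) (x : seq T) a b : size x = a + b ->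
  exists x1 x2, [/\ x = x1 ++ x2, size x1 = a & size x2 = b].
Proof.
move=> h; exists (take a x), (drop a x).
by rewrite cat_take_drop size_drop size_takel h ?leq_addr // addKn.
Qed.

Lemma size_eval t x : wt t -> size x = src t -> size (eval t x) = tgt t.
Proof.
elim: t x => [n|m n|m n|g|f IHf g IHg|f IHf g IHg] x.
- by [].
- by move=> _ /size_split[x1 [x2 [-> h1 h2]]]; rewrite eval_br // size_cat h1 h2.
- by move=> _ /size_split[x1 [x2 [-> h1 h2]]]; rewrite eval_brinv // size_cat h1 h2.
- by case: g.
- by move=> /and3P[wf wg /eqP e] h; rewrite /= IHf // IHg.
- move=> /andP[wf wg] /size_split[x1 [x2 [-> h1 h2]]].
  by rewrite eval_tens // size_cat IHf // IHg.
Qed.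

Lemma bmc_eval t1 t2 x : bmc_rel t1 t2 -> wt t1 -> size x = src t1 ->
  eval t1 x = eval t2 x.
Proof.
case=> {t1 t2}.
- by [].
- by [].
- by [].
- by move=> f m n _ _ _ /=; rewrite take0 drop0.
- move=> f m n _ w /=; rewrite addn0 => h.
  by rewrite take_oversize ?drop_oversize ?h // cats0.
- move=> f g h > _ _ _ _ /size_split[y [x3 [-> /size_split[x1 [x2 [-> h1 h2]]] h3]]].
  rewrite (@eval_tens (Tens f g)) ?size_cat ?h1 ?h2 // eval_tens //.
  by rewrite -[in RHS]catA !eval_tens // catA.
- by move=> m n _ _ /=; rewrite cat_take_drop.
- move=> f f' g g' a b c p q r tf' tf tg' tg _ /size_split[x1 [x2 [-> h1 h2]]].
  have [wf' e1 e2] := (typedE _ _ _).1 tf'.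
  rewrite -[LHS]/(eval (Tens f g) (eval (Tens f' g') (x1 ++ x2))).
  rewrite (@eval_tens f' g') // (@eval_tens f g) ?(@eval_tens (Comp f f')) //.
  by rewrite size_eval // e2 (typed_src tf).
- move=> f g m m' n n' tf tg _ /= h.
  have [wf e1 e2] := (typedE _ _ _).1 tf; have [wg e3 e4] := (typedE _ _ _).1 tg.
  have [x1 [x2 [-> h1 h2]]] := size_split h.
  rewrite -[drop m' _ ++ _]/(eval (Br m' n') (eval (Tens f g) (x1 ++ x2))).
  rewrite eval_tens // eval_br ?size_eval //.
  rewrite -[RHS]/(eval (Tens g f) (eval (Br m n) (x1 ++ x2))).
  by rewrite eval_br ?h1 // eval_tens // h2.
- move=> l m n _ /size_split[x1 [x2 [-> h1 /size_split[x2' [x3 [-> h2 h3]]]]]].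
  have e : eval (Tens (Br l m) (Id n)) (x1 ++ x2' ++ x3) = x2' ++ (x1 ++ x3).
    by rewrite catA eval_tens ?size_cat ?h1 ?h2 // eval_br // -catA.
  rewrite eval_br // -[RHS]/(eval (Tens (Id m) (Br l n)) (eval (Tens (Br l m) (Id n)) _)).
  by rewrite e eval_tens // eval_br // catA.
- move=> l m n _ /size_split[y [x3 [-> /size_split[x1 [x2 [-> h1 h2]]] h3]]].
  have e : eval (Tens (Id l) (Br m n)) ((x1 ++ x2) ++ x3) = (x1 ++ x3) ++ x2.
    by rewrite -catA eval_tens // eval_br // -catA.
  rewrite eval_br ?size_cat ?h1 ?h2 //.
  rewrite -[RHS]/(eval (Tens (Br l n) (Id m)) (eval (Tens (Id l) (Br m n)) _)).
  by rewrite e eval_tens ?size_cat ?h1 ?h3 // eval_br // catA.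
- move=> m n _ /size_split[x1 [x2 [-> h1 h2]]].
  rewrite -[LHS]/(eval (Br m n) (eval (BrInv m n) _)).
  by rewrite eval_brinv // eval_br.
- move=> m n _ /size_split[x1 [x2 [-> h1 h2]]].
  rewrite -[LHS]/(eval (BrInv m n) (eval (Br m n) _)).
  by rewrite eval_br // eval_brinv.
Qed.

(** * Evaluation annihilates the ideal *)

Section Soundness.
Variable F : fieldType.
Local Open Scope ring_scope.
Local Notation V := (@V_CommCocHopf F).

(** Grouping by the value of [e]: vanishing of each fibre sum, the form in which [EH_zero] and zero
    coefficients are given, yields vanishing against every function [phi]. *)
Lemma fiber_sum (T : Type) (K : eqType) (c : seq (F * T)) (e : T -> K) :
  (forall y, \sum_(p <- c | e p.2 == y) p.1 = 0) ->
  forall phi : K -> F, \sum_(p <- c) p.1 * phi (e p.2) = 0.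
Proof.
move=> h phi; pose r := undup [seq e p.2 | p <- c].
have ur : uniq r by apply: undup_uniq.
have sub : {subset [seq e p.2 | p <- c] <= r} by move=> y; rewrite mem_undup.
clearbody r.
have -> : \sum_(p <- c) p.1 * phi (e p.2) =
   \sum_(p <- c) \sum_(y <- r) (if e p.2 == y then p.1 * phi y else 0).
  elim: c {h} sub => [|p c IH] sub; first by rewrite !big_nil.
  rewrite !big_cons IH; last by move=> y hy; apply: sub; rewrite inE hy orbT.
  congr (_ + _); rewrite (bigD1_seq (e p.2)) ?eqxx //=; last by apply: sub; rewrite mem_head.
  by rewrite big1 ?addr0 // => y /negPf; rewrite eq_sym => ->.
rewrite exchange_big big1 // => y _.
by rewrite -big_mkcond -mulr_suml h mul0r.
Qed.

Lemma eq_coef_sum (c c' : comb F) (phi : tm -> F) :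
  (forall t, coef c t = coef c' t) ->
  \sum_(p <- c) p.1 * phi p.2 = \sum_(p <- c') p.1 * phi p.2.
Proof.
move=> h; have e t : \sum_(p <- c ++ scale (-1) c' | p.2 == t) p.1 = 0.
  rewrite big_cat big_map /= -/(coef c t) h.
  under [X in _ + X]eq_bigr do rewrite mulN1r.
  by rewrite sumrN subrr.
have := fiber_sum (e := id) e phi.
rewrite big_cat big_map /=; under [X in _ + X]eq_bigr do rewrite mulN1r mulNr.
by rewrite sumrN => /eqP; rewrite subr_eq0 => /eqP.
Qed.

Lemma V_eval m n c : V m n c -> exists t t', c = diff F t t' /\
  forall x : seq G, size x = m -> eval t x = eval t' x.
Proof.
case=> {m n c} [m n c [] | |]; eexists; eexists; (split; first reflexivity);
  move=> x; do 4?[case: x => [|? x] //=] => _; rewrite ?addrA ?add0r ?addr0 ?subrr ?addNr ?oppr0 //.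
by rewrite addrC.
Qed.

Lemma V_EH_zero m n c : V m n c -> EH_zero m c.
Proof.
case/V_eval=> t [t' [-> h]] x hx y.
by rewrite !big_cons big_nil /= (h _ hx); case: eqP; rewrite ?addr0 ?subrr.
Qed.

(** The induction needs arbitrary [phi]: composing or tensoring with [h] is absorbed by changing
    [phi] or [x]. Typing is carried along because tensoring on the right splits the input at the
    source of each term. *)
Lemma Ideal_sound m n c : Ideal V m n c -> typed_comb m n c /\
  forall x : seq G, size x = m -> forall phi : seq G -> F,
    \sum_(p <- c) p.1 * phi (eval p.2 x) = 0.
Proof.
elim=> {m n c}.
- move=> m n c vc tc; split=> // x hx; apply: (@fiber_sum _ _ c (fun t => eval t x)).
  exact: V_EH_zero vc x hx.
- move=> m n t1 t2 h1 h2 r; split; first exact: diff_typed.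
  move=> x hx phi; rewrite !big_cons big_nil /=.
  have [w s _] := (typedE _ _ _).1 h1.
  by rewrite (bmc_eval r w) ?s // addr0 mul1r mulN1r subrr.
- by move=> m n; split=> // x _ phi; rewrite big_nil.
- move=> m n c c' _ [_ h] tc' ec; split=> // x hx phi.
  by rewrite -(eq_coef_sum (fun t => phi (eval t x)) ec) h.
- move=> m n c1 c2 _ [t1 h1] _ [t2 h2]; split=> [p|x hx phi].
    by rewrite mem_cat => /orP[/t1|/t2].
  by rewrite big_cat /= h1 // h2 // addr0.
- move=> m n a c _ [t h]; split=> [p /mapP[q /t hq ->] //|x hx phi].
  rewrite big_map /=; under eq_bigr do rewrite -mulrA.
  by rewrite -mulr_sumr h // mulr0.
- move=> m n p h c th _ [t e]; split=> [q /mapP[q' /t hq ->]|x hx phi].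
    exact: ty_comp hq th.
  by rewrite big_map; apply: (e x hx (fun y => phi (eval h y))).
- move=> l m n h c th _ [t e]; split=> [q /mapP[q' /t hq ->]|x hx phi].
    exact: ty_comp th hq.
  have [w s g] := (typedE _ _ _).1 th.
  by rewrite big_map; apply: (e (eval h x)); rewrite size_eval ?g ?s.
- move=> m n p q h c th _ [t e]; split=> [r /mapP[r' /t hr ->]|x hx phi].
    exact: ty_tens.
  have [x1 [x2 [ex h1 h2]]] := size_split hx.
  rewrite big_map /= -[RHS](e x2 h2 (fun y => phi (eval h x1 ++ y))).
  apply: eq_bigr => r _; rewrite (typed_src th) ex.
  by rewrite -h1 take_size_cat ?drop_size_cat.
- move=> m n p q h c th _ [t e]; split=> [r /mapP[r' /t hr ->]|x hx phi].
    exact: ty_tens.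
  have [x1 [x2 [ex h1 h2]]] := size_split hx.
  rewrite big_map /= -[RHS](e x1 h1 (fun y => phi (y ++ eval h x2))).
  rewrite !big_seq; apply: eq_bigr => r /t hr; rewrite (typed_src hr) ex.
  by rewrite -h1 take_size_cat ?drop_size_cat.
Qed.

Lemma Ideal_EH_zero m n c : Ideal V m n c -> EH_zero m c.
Proof.
move=> /Ideal_sound[_ h] x hx y.
rewrite -[RHS](h x hx (fun z => (z == y)%:R)) [LHS]big_mkcond.
by apply: eq_bigr => p _; case: eqP; rewrite ?mulr1 ?mulr0.
Qed.

Lemma teq_eval m n t t' x : typed t m n -> teq F t t' -> size x = m ->
  eval t x = eval t' x.
Proof.
move=> tt e hx; have := Ideal_EH_zero (teq_ideal tt e) hx (eval t x).
rewrite !big_cons big_nil eqxx /=; case: eqP => [-> //|_] /eqP.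
by rewrite addr0 oner_eq0.
Qed.
End Soundness.

Lemma eval_eps m x : size x = m -> eval (eps m) x = [::].
Proof.
elim: m x => [|m IH] [|a x] // [h].
by rewrite epsS (@eval_tens ep (eps m) [:: a] x) //= IH.
Qed.

Lemma eval_diag m x : size x = m -> eval (diag m) x = x ++ x.
Proof.
elim: m x => [|m IH] [|a x] // [h].
rewrite diagS.
rewrite -[LHS]/(eval (Tens (Id 1) (Tens (Br 1 m) (Id m))) (eval (Tens De (diag m)) ([:: a] ++ x))).
rewrite eval_tens // IH //.
rewrite -[_ ++ _]/([:: a] ++ ([:: a] ++ (x ++ x))) eval_tens // catA eval_tens ?eval_br //=.
  by rewrite -catA.
by rewrite h.
Qed.

Section EvalHom.
Local Open Scope ring_scope.

Lemma eval_conv m f g a b x : size x = m -> src f = m ->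
  eval f x = [:: a] -> eval g x = [:: b] -> eval (conv m f g) x = [:: a + b].
Proof.
move=> hx sf ef eg.
rewrite -[LHS]/(eval mu (eval (Tens f g) (eval (diag m) x))).
by rewrite eval_diag // eval_tens ?ef ?eg ?sf.
Qed.

Lemma eval_unit m x : size x = m -> eval (unit_hom m) x = [:: 0].
Proof. by move=> h; rewrite -[LHS]/(eval un (eval (eps m) x)) eval_eps. Qed.

Lemma eval_pr n k x : size x = n -> (k < n)%N -> eval (pr n k) x = [:: nth 0 x k].
Proof.
move=> h lt; rewrite -{1}(cat_take_drop k x) (drop_nth 0) ?h // /pr.
rewrite eval_tens ?src_eps ?size_takel ?h 1?ltnW // eval_eps ?size_takel ?h 1?ltnW //.
by rewrite (@eval_tens (Id 1) _ [:: _]) // eval_eps // size_drop h.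
Qed.

Lemma eval_zpow m z g a x : hom1 m g -> size x = m -> eval g x = [:: a] ->
  eval (zpow m z g) x = [:: a *~ z].
Proof.
move=> hg hx ea.
have hi k f b : hom1 m f -> eval f x = [:: b] ->
    eval (iter k (conv m f) (unit_hom m)) x = [:: b *+ k].
  move=> /and3P[_ /eqP sf _] ef; elim: k => [|k IH]; first by rewrite eval_unit.
  by rewrite iterS (eval_conv hx sf ef IH) mulrS.
case: z => k; first exact: hi.
rewrite /zpow (hi _ _ (- a)) ?hom_S // => [|/=]; last by rewrite ea.
by rewrite NegzE mulrNz -mulNrn.
Qed.

Lemma eval_lin m l a x : all (fun i => i < m)%N l -> size x = m ->
  eval (lin m l a) x = [:: \sum_(i <- l) nth 0 x i *~ a i].
Proof.
move=> + hx; elim: l => [|i l IH]; first by rewrite big_nil eval_unit.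
move=> /= /andP[lt al]; rewrite big_cons; have hp := hom_pr lt.
have /and3P[_ /eqP sz _] := hom_zpow (a i) hp.
by apply: eval_conv => //; [apply: eval_zpow; rewrite ?eval_pr | apply: IH].
Qed.

End EvalHom.

(** * Typing and values of the terms [psi_term s] *)

Lemma src_tens_list l : src (tens_list l) = sumn [seq src t | t <- l].
Proof. by elim: l => //= t l ->. Qed.
Lemma tgt_tens_list l : tgt (tens_list l) = sumn [seq tgt t | t <- l].
Proof. by elim: l => //= t l ->. Qed.
Lemma wt_tens_list l : wt (tens_list l) = all wt l.
Proof. by elim: l => //= t l ->. Qed.

Lemma typed_Dn p : typed (Dn p) 1 p.
Proof.
elim: p => [|[|q] IH] /=; [exact: (ty_gen Geps) | exact: ty_id |].
apply: ty_comp IH _; exact: ty_tens (ty_gen GDelta) (ty_id q).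
Qed.

Lemma typed_Mn p : typed (Mn p) p 1.
Proof.
elim: p => [|[|q] IH] /=; [exact: (ty_gen Gu) | exact: ty_id |].
by apply: ty_comp (ty_gen Gmu); have := ty_tens IH (ty_id 1); rewrite addn1.
Qed.

Lemma eval_Dn p a : eval (Dn p) [:: a] = nseq p a.
Proof.
elim: p => [|[|q] IH] //.
rewrite -[LHS]/(eval (Tens De (Id q)) (eval (Dn q.+1) [:: a])) IH.
by rewrite -[nseq q.+1 a]/([:: a] ++ nseq q a) eval_tens.
Qed.

Lemma eval_Mn p x : size x = p -> eval (Mn p) x = [:: \sum_(a <- x) a]%R.
Proof.
elim: p x => [|[|q] IH] x.
- by case: x => // _; rewrite big_nil.
- by case: x => [|a []] // _; rewrite big_seq1.
case/lastP: x => // x a; rewrite size_rcons => -[hx].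
rewrite -[LHS]/(eval mu (eval (Tens (Mn q.+1) (Id 1)) (rcons x a))) -cats1.
have [_ s _] := (typedE _ _ _).1 (typed_Mn q.+1).
by rewrite eval_tens ?s // IH // big_cat big_seq1.
Qed.

Definition good_ord N (o : seq nat) := [&& size o == N, uniq o & all (fun i => i < N) o].

(** Once strand [j] has been moved to the front, the strands behind it are renumbered down by one,
    as in the recursion of [permt]. *)
Lemma good_ord_cons N j o : good_ord N.+1 (j :: o) ->
  j <= N /\ good_ord N [seq (if i < j then i else i.-1)%N | i <- o].
Proof.
case/and3P=> /eqP[so] /= /andP[jo uo] /andP[lj ao]; split=> //.
rewrite /good_ord size_map so eqxx /= map_inj_in_uniq ?uo /=; last first.
  have inj (i1 i2 : nat) : i1 <> j -> i2 <> j ->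
      (if i1 < j then i1 else i1.-1) = (if i2 < j then i2 else i2.-1) -> i1 = i2.
    by move=> n1 n2; case: (ltnP i1 j); case: (ltnP i2 j); lia.
  by move=> i1 i2 h1 h2; apply: inj => e; rewrite -e ?h1 ?h2 in jo.
apply/allP=> _ /mapP[i hi ->].
have n1 : i <> j by move=> e; rewrite -e hi in jo.
have /= := allP ao _ hi; move: i n1 {hi} => i n1; case: (ltnP i j); lia.
Qed.

Lemma typed_permt N o : good_ord N o -> typed (permt N o) N N.
Proof.
elim: N o => [|N IH] [|j o] h; [exact: ty_id|exact: ty_id|by []|].
have [lj /IH h'] := good_ord_cons h; rewrite /=.
have e1 := ty_tens (ty_br j 1) (ty_id (N - j)).
have e2 := ty_tens (ty_id 1) h'.
have eq1 : j + 1 + (N - j) = N.+1 by lia.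
have eq2 : 1 + j + (N - j) = 1 + N by lia.
by rewrite eq1 eq2 in e1; apply: ty_comp e1 e2.
Qed.

Lemma eval_permt N o x : good_ord N o -> size x = N ->
  eval (permt N o) x = [seq nth 0%R x i | i <- o].
Proof.
elim: N o x => [|N IH] [|j o] // x h hx; first by case: x hx.
have [lj h'] := good_ord_cons h; have /and3P[_ /= /andP[jo _] _] := h.
have [x1 [y [x2 [ex h1 h2]]]] : exists x1 y x2,
    [/\ x = (x1 ++ [:: y]) ++ x2, size x1 = j & size x2 = N - j].
  have [x1 [x2 [-> h1]]] : exists x1 x2, [/\ x = x1 ++ x2, size x1 = j & size x2 = (N - j).+1].
    by apply: size_split; lia.
  by case: x2 => // y x2 [h2]; exists x1, y, x2; rewrite -catA.
set o' := [seq _ | i <- o] in h'.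
rewrite -[LHS]/(eval (Tens (Id 1) (permt N o'))
                     (eval (Tens (Br j 1) (Id (N - j))) x)).
rewrite ex eval_tens ?size_cat ?h1 // eval_br // -[_ ++ eval _ _]/([:: y] ++ (x1 ++ x2)).
rewrite eval_tens // IH //; last by rewrite size_cat h1 h2; lia.
rewrite /= -catA nth_cat h1 ltnn subnn /=; congr (_ :: _).
rewrite -map_comp; apply/eq_in_map=> i hi /=.
have ne : i <> j by move=> e; rewrite -e hi in jo.
case: (ltnP i j) => lt; rewrite !nth_cat h1; first by rewrite lt.
have -> : (i < j) = false by lia.
have -> : (i.-1 < j) = false by lia.
by have -> : i - j = (i.-1 - j).+1 by lia.
Qed.

Lemma eval_tens_list_cat l1 l2 x1 x2 : size x1 = src (tens_list l1) ->
  eval (tens_list (l1 ++ l2)) (x1 ++ x2) =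
  eval (tens_list l1) x1 ++ eval (tens_list l2) x2.
Proof.
elim: l1 x1 => [|t l IH] x1 /=; first by move/size0nil->.
case/size_split=> y1 [y2 [-> h1 h2]].
by rewrite -catA -!h1 !take_size_cat ?drop_size_cat // IH // catA.
Qed.

Lemma eval_tens_list_flatten (I : Type) (r : seq I) (f : I -> seq tm) (g : I -> seq G) :
  (forall i, size (g i) = src (tens_list (f i))) ->
  eval (tens_list (flatten [seq f i | i <- r])) (flatten [seq g i | i <- r]) =
  flatten [seq eval (tens_list (f i)) (g i) | i <- r].
Proof. by move=> h; elim: r => //= i r IH; rewrite eval_tens_list_cat // IH. Qed.

Lemma tens_list1 t x : size x = src t -> eval (tens_list [:: t]) x = eval t x.
Proof. by move=> h; rewrite /= -h take_size drop_size cats0. Qed.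

Lemma flatten_map1s (I J : Type) (r : seq I) (f : I -> J) :
  flatten [seq [:: f i] | i <- r] = map f r.
Proof. by elim: r => //= i r ->. Qed.

Lemma eval_tens_list_map (I : Type) (r : seq I) (f : I -> tm) (g : I -> seq G) :
  (forall i, size (g i) = src (f i)) ->
  eval (tens_list [seq f i | i <- r]) (flatten [seq g i | i <- r]) =
  flatten [seq eval (f i) (g i) | i <- r].
Proof.
move=> h; rewrite -flatten_map1s eval_tens_list_flatten => [|i].
  by congr flatten; apply: eq_map => i; rewrite tens_list1.
by rewrite /= addn0.
Qed.

Lemma enum_lift n : enum 'I_n.+1 = ord0 :: [seq fintype.lift ord0 i | i <- enum 'I_n].
Proof. exact: enum_ordSl. Qed.

Lemma prefix_sum_lift n (p : 'I_n.+1 -> nat) (k : 'I_n) :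
  \sum_(i < n.+1 | i < fintype.lift ord0 k) p i =
  p ord0 + \sum_(i < n | i < k) p (fintype.lift ord0 i).
Proof. by rewrite big_mkcond big_ord_recl /= -big_mkcond. Qed.

(** Blocks placed at their prefix sums tile an interval. It serves twice: across variables for
    [off], and within one variable across factors for [before]. *)
Lemma iota_blocks n (p : 'I_n -> nat) c :
  flatten [seq [seq c + \sum_(i < n | i < k) p i + j | j <- iota 0 (p k)]
             | k : 'I_n <- enum 'I_n] = iota c (\sum_(k < n) p k).
Proof.
elim: n p c => [|n IH] p c.
  by rewrite big_ord0 (size0nil (_ : size (enum 'I_0) = 0)) // size_enum_ord.
rewrite enum_lift /= big_ord_recl iotaD -map_comp; congr (_ ++ _).
  by rewrite big1 ?addn0 => [|i]; rewrite ?ltn0 // -iotaDl addn0.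
rewrite -IH; congr flatten; apply: eq_map => k /=.
by rewrite prefix_sum_lift addnA.
Qed.

Lemma nth_blocks (T : Type) d n (p : 'I_n -> nat) (x : 'I_n -> T) r i : i < p r ->
  nth d (flatten [seq nseq (p r) (x r) | r <- enum 'I_n])
    (\sum_(r' < n | r' < r) p r' + i) = x r.
Proof.
elim: n p x r => [|n IH] p x r; first by case: r.
rewrite enum_lift /= -map_comp nth_cat size_nseq.
case: (unliftP ord0 r) => [r'|] -> lt.
  rewrite prefix_sum_lift -addnA ltnNge leq_addr /= addKn.
  exact: (IH (fun r => p (fintype.lift ord0 r)) (fun r => x (fintype.lift ord0 r))).
by rewrite big1 => [|j]; rewrite ?ltn0 // add0n lt nth_nseq lt.
Qed.

Section PsiTerm.
Variables m n : nat.
Variable s : 'M[int]_(n, m).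

(** [psi_ord] runs through factors first and variables second. In the opposite order the same blocks
    tile an interval, and exchanging nested concatenations preserves counts. *)
Lemma psi_ord_perm : perm_eq (psi_ord s) (iota 0 (\sum_(r < m) Nr s r)).
Proof.
have <- : flatten [seq flatten [seq [seq off s r + before s k r + j | j <- iota 0 (pkr s k r)]
             | k <- enum 'I_n] | r <- enum 'I_m] = iota 0 (\sum_(r < m) Nr s r).
  rewrite -iota_blocks; congr flatten; apply: eq_map => r.
  rewrite (iota_blocks (fun k => pkr s k r)) -[in RHS]/(off s r) add0n.
  by rewrite -iotaDl addn0.
apply/permP => a; rewrite !count_flatten -!map_comp !sumnE !big_map.
under eq_bigr do rewrite /= count_flatten sumnE !big_map.
under [RHS]eq_bigr do rewrite /= count_flatten sumnE !big_map.
by rewrite exchange_big.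
Qed.

Lemma psi_ord_good : good_ord (\sum_(r < m) Nr s r) (psi_ord s).
Proof.
have h := psi_ord_perm; rewrite /good_ord (perm_size h) size_iota eqxx.
rewrite (perm_uniq h) iota_uniq (perm_all _ h).
by apply/allP => i; rewrite mem_iota.
Qed.

Lemma sum_Pk : \sum_(k < n) Pk s k = \sum_(r < m) Nr s r.
Proof. exact: exchange_big. Qed.

Lemma sumn_enum l (f : 'I_l -> nat) : sumn [seq f r | r <- enum 'I_l] = \sum_(r < l) f r.
Proof. by rewrite sumnE big_map big_enum. Qed.

Definition sign_tm (z : int) : tm := if (z < 0)%R then Sg else Id 1.

Lemma size_sign (k : 'I_n) (f : 'I_m -> tm) :
  size (flatten [seq nseq (pkr s k r) (f r) | r <- enum 'I_m]) = Pk s k.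
Proof.
rewrite size_flatten /shape -map_comp (eq_map (_ : _ =1 pkr s k)) ?sumn_enum //.
by move=> r; rewrite /= size_nseq.
Qed.

Lemma typed_psi_D : typed (psi_D s) m (\sum_(r < m) Nr s r).
Proof.
have h r := (typedE _ _ _).1 (typed_Dn (Nr s r)).
apply/typedE; split.
- by rewrite wt_tens_list all_map; apply/allP => r _ /=; have [] := h r.
- rewrite src_tens_list -map_comp (eq_map (_ : _ =1 fun=> 1)) ?sumn_enum.
    by rewrite sum1_card card_ord.
  by move=> r /=; have [] := h r.
- rewrite tgt_tens_list -map_comp (eq_map (_ : _ =1 Nr s)) ?sumn_enum //.
  by move=> r /=; have [] := h r.
Qed.

Lemma typed_psi_M : typed (psi_M s) (\sum_(r < m) Nr s r) n.
Proof.
have h r := (typedE _ _ _).1 (typed_Mn (Pk s r)).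
apply/typedE; split.
- by rewrite wt_tens_list all_map; apply/allP => r _ /=; have [] := h r.
- rewrite src_tens_list -map_comp (eq_map (_ : _ =1 Pk s)) ?sumn_enum ?sum_Pk //.
  by move=> r /=; have [] := h r.
- rewrite tgt_tens_list -map_comp (eq_map (_ : _ =1 fun=> 1)) ?sumn_enum.
    by rewrite sum1_card card_ord.
  by move=> r /=; have [] := h r.
Qed.

Lemma typed_tens_list1 l : all (fun t => [&& wt t, src t == 1 & tgt t == 1]) l ->
  typed (tens_list l) (size l) (size l).
Proof.
elim: l => [|t l IH] /=; first by move=> _; apply: ty_id.
case/andP=> /and3P[w /eqP s1 /eqP t1] /IH; apply: (@ty_tens _ _ 1 1).
exact/typedE.
Qed.

Lemma typed_psi_S : typed (psi_S s) (\sum_(r < m) Nr s r) (\sum_(r < m) Nr s r).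
Proof.
rewrite -sum_Pk -sumn_enum.
set l := flatten [seq flatten [seq nseq (pkr s k r) (sign_tm (s k r)) | r <- enum 'I_m]
                 | k <- enum 'I_n].
have <- : size l = sumn [seq Pk s k | k <- enum 'I_n].
  rewrite size_flatten /shape -map_comp; congr sumn; apply: eq_map => k.
  exact: size_sign.
apply: typed_tens_list1; apply/allP => t /flattenP[_ /mapP[k _ ->]].
by case/flattenP=> _ /mapP[r _ ->] /nseqP[-> _]; rewrite /sign_tm; case: ifP.
Qed.

Lemma typed_psi_term : typed (psi_term s) m n.
Proof.
apply: ty_comp typed_psi_M; apply: ty_comp typed_psi_S.
exact: ty_comp typed_psi_D (typed_permt psi_ord_good).
Qed.

Lemma eval_psi_D (x : 'I_m -> G) : eval (psi_D s) [seq x r | r <- enum 'I_m] =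
  flatten [seq nseq (Nr s r) (x r) | r <- enum 'I_m].
Proof.
rewrite -flatten_map1s eval_tens_list_map => [|r].
  by congr flatten; apply: eq_map => r; rewrite eval_Dn.
by rewrite (typed_src (typed_Dn _)).
Qed.

Lemma pkr_before k r j : j < pkr s k r -> before s k r + j < Nr s r.
Proof.
move=> lt; rewrite /Nr (bigID (fun k' : 'I_n => k' < k)) /= -/(before s k r) ltn_add2l.
by rewrite (bigD1 k) ?ltnn //=; apply: ltn_addr.
Qed.

Lemma eval_psi_P (x : 'I_m -> G) :
  eval (psi_P s) (flatten [seq nseq (Nr s r) (x r) | r <- enum 'I_m]) =
  flatten [seq flatten [seq nseq (pkr s k r) (x r) | r <- enum 'I_m] | k <- enum 'I_n].
Proof.
rewrite eval_permt ?psi_ord_good //; last first.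
  rewrite size_flatten /shape -map_comp (eq_map (_ : _ =1 Nr s)) ?sumn_enum //.
  by move=> r /=; rewrite size_nseq.
rewrite map_flatten -map_comp; congr flatten; apply: eq_map => k /=.
rewrite map_flatten -map_comp; congr flatten; apply: eq_map => r /=.
rewrite -map_comp; apply: (@eq_from_nth _ 0%R) => [|i].
  by rewrite size_map size_iota size_nseq.
rewrite size_map size_iota => lt; rewrite (nth_map 0) ?size_iota // nth_iota //=.
by rewrite nth_nseq lt add0n -addnA nth_blocks // pkr_before.
Qed.

Lemma eval_sign_nseq p z a :
  eval (tens_list (nseq p (sign_tm z))) (nseq p a) =
  nseq p (if (z < 0)%R then - a else a)%R.
Proof.
elim: p => // p IH; rewrite -[nseq p.+1 a]/([:: a] ++ nseq p a).
rewrite -[tens_list _]/(Tens (sign_tm z) (tens_list (nseq p (sign_tm z)))) eval_tens.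
  by rewrite IH /sign_tm /=; case: (z < 0)%R.
by rewrite /sign_tm; case: ifP.
Qed.

Lemma src_sign_nseq p z : src (tens_list (nseq p (sign_tm z))) = p.
Proof. by elim: p => //= p ->; rewrite /sign_tm; case: ifP. Qed.

Lemma eval_psi_S (x : 'I_m -> G) :
  eval (psi_S s)
   (flatten [seq flatten [seq nseq (pkr s k r) (x r) | r <- enum 'I_m] | k <- enum 'I_n]) =
  flatten [seq flatten [seq nseq (pkr s k r) (if (s k r < 0)%R then - x r else x r)%R
    | r <- enum 'I_m] | k <- enum 'I_n].
Proof.
rewrite eval_tens_list_flatten => [|k].
  congr flatten; apply: eq_map => k; rewrite eval_tens_list_flatten => [|r].
    by congr flatten; apply: eq_map => r; apply: eval_sign_nseq.
  by rewrite size_nseq src_sign_nseq.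
elim: (enum 'I_m) => //= r l IH.
rewrite size_cat IH size_nseq !src_tens_list map_cat sumn_cat -!src_tens_list.
by rewrite src_sign_nseq.
Qed.

Lemma eval_psi_M (y : 'I_n -> 'I_m -> G) :
  eval (psi_M s)
   (flatten [seq flatten [seq nseq (pkr s k r) (y k r) | r <- enum 'I_m] | k <- enum 'I_n]) =
  [seq \sum_(r < m) y k r *+ pkr s k r | k <- enum 'I_n]%R.
Proof.
have hs k : size (flatten [seq nseq (pkr s k r) (y k r) | r <- enum 'I_m]) = Pk s k.
  rewrite size_flatten /shape -map_comp (eq_map (_ : _ =1 pkr s k)) ?sumn_enum //.
  by move=> r; rewrite /= size_nseq.
rewrite eval_tens_list_map => [|k]; last by rewrite hs (typed_src (typed_Mn _)).
rewrite -[RHS]flatten_map1s; congr flatten; apply: eq_map => k.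
rewrite eval_Mn // big_flatten big_map big_enum; congr [:: _]; apply: eq_bigr => r _.
by rewrite big_nseq -Monoid.iteropE.
Qed.

Lemma eval_psi_term (x : 'I_m -> G) :
  eval (psi_term s) [seq x r | r <- enum 'I_m] =
  [seq \sum_(r < m) x r *~ s k r | k <- enum 'I_n]%R.
Proof.
rewrite -[LHS]/(eval (psi_M s) (eval (psi_S s) (eval (psi_P s) (eval (psi_D s) _)))).
rewrite eval_psi_D eval_psi_P eval_psi_S eval_psi_M.
apply: eq_map => k; apply: eq_bigr => r _; rewrite /pkr.
by case: (s k r) => p //=; rewrite NegzE mulrNz mulNrn.
Qed.
End PsiTerm.

Lemma lin_ext m l a b : {in l, a =1 b} -> lin m l a = lin m l b.
Proof.
elim: l => //= i l IH h; rewrite h ?mem_head // IH // => j jl.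
by rewrite h // inE jl orbT.
Qed.

(** The universal test point: by freeness, an integer combination of these elements determines its
    coefficients. *)
Definition gens m : seq G := [seq (<< (r : nat) >>)%R | r : 'I_m <- enum 'I_m].

Lemma size_gens m : size (gens m) = m.
Proof. by rewrite size_map size_enum_ord. Qed.

Lemma coeff_gens m (z : 'I_m -> int) (r : 'I_m) :
  coeff (r : nat) (\sum_(i < m) << (i : nat) >> *~ z i)%R = z r.
Proof.
rewrite raddf_sum (bigD1 r) //= big1 => [|i ne].
  by rewrite raddfMz /= coeffU eqxx mul1r addr0 intz.
by rewrite raddfMz /= coeffU (inj_eq val_inj) (negPf ne) mulr0 mul0rz.
Qed.

Lemma eval_lin_gens m a : eval (lin m (iota 0 m) a) (gens m) =
  [:: \sum_(i < m) << (i : nat) >> *~ a i]%R.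
Proof.
rewrite eval_lin ?size_gens ?all_iota0 // -[in iota 0 m](subn0 m) big_mkord.
congr [:: _]; apply: eq_bigr => i _; congr (_ *~ _)%R.
by rewrite (nth_map i) ?size_enum_ord // nth_ord_enum.
Qed.

Lemma eval_psi_term_inj m n (s s' : 'M[int]_(n, m)) :
  eval (psi_term s) (gens m) = eval (psi_term s') (gens m) -> s = s'.
Proof.
rewrite !eval_psi_term => /eq_in_map h; apply/matrixP => k r.
by rewrite -(coeff_gens (s k) r) h ?mem_enum // coeff_gens.
Qed.

(** * Normal forms, bijectivity of [psi], and the identities *)

Section Main.
Variable F : fieldType.
Local Notation V := (@V_CommCocHopf F).

(** The matrix collects the coefficients of the projections of [t]. Each projection of [psi_term s]
    is also some combination, with unknown [b]; evaluating at [gens] identifies [b] with the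
    matching row, and joint monicity concludes. *)
Lemma teq_psi_term t m n : typed t m n -> exists s : 'M[int]_(n, m), teq F t (psi_term s).
Proof.
move=> tt; have [wt_t st gt] := (typedE _ _ _).1 tt.
have hk (k : 'I_n) : exists a, teq F (Comp (pr n k) t) (lin m (iota 0 m) a).
  by have := @all_spanned_all F t wt_t k; rewrite st gt; apply.
have [a ha] := fin_all_exists hk.
pose s : 'M[int]_(n, m) := (\matrix_(k, r) a k r)%R; exists s.
have ts := typed_psi_term s; have [ws ss gs] := (typedE _ _ _).1 ts.
apply: (@jointly_monic F n) => //; first by rewrite st.
move=> k lt; have {}ha := ha (Ordinal lt).
have [b hb] : spanned F m (Comp (pr n k) (psi_term s)).
  by have := @all_spanned_all F _ ws k; rewrite ss gs; apply.
have tk : typed (Comp (pr n k) (psi_term s)) m 1.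
  by apply: ty_comp ts _; apply/typedE; rewrite wt_pr src_pr // tgt_pr.
have := teq_eval tk hb (size_gens m); rewrite eval_lin_gens.
rewrite -[LHS]/(eval (pr n k) (eval (psi_term s) (gens m))) eval_psi_term.
rewrite eval_pr //; last by rewrite size_map size_enum_ord.
case.
rewrite (nth_map (Ordinal lt)) ?size_enum_ord // (nth_ord_enum _ (Ordinal lt)) => e.
apply: teq_trans ha (teq_sym _); apply: teq_trans hb _.
rewrite (@lin_ext _ _ _ (a (Ordinal lt))) => [|r]; first exact: teq_refl.
rewrite mem_iota => /= lr; rewrite -(coeff_gens b (Ordinal lr)) -e.
by rewrite coeff_gens mxE.
Qed.

Lemma Ideal_sum m n (c : seq (F * (tm * tm))) :
  (forall p, p \in c -> typed p.2.1 m n /\ teq F p.2.1 p.2.2) ->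
  Ideal V m n ([seq (p.1, p.2.1) | p <- c] ++ scale (-1)%R [seq (p.1, p.2.2) | p <- c]).
Proof.
elim: c => [|[x [t t']] c IH] h; first exact: Id_nil.
have [h1 h2] := h _ (mem_head _ _).
have I1 := Id_scale x (teq_ideal h1 h2).
have /IH I2 : forall p, p \in c -> typed p.2.1 m n /\ teq F p.2.1 p.2.2.
  by move=> p pc; apply: h; rewrite inE pc orbT.
apply: Id_rep (Id_add I1 I2) _ _.
  move=> p; rewrite mem_cat => /orP[/mapP[q qc ->]|/mapP[q' /mapP[q qc ->] ->]] /=.
    by have [] := h _ qc.
  by have [u v] := h _ qc; apply: teq_typed v.
move=> s; rewrite !coef_indic !big_cat /= !big_cons big_nil /= !big_map /=.
ring.
Qed.

Lemma psi_typed m n (f : fcomb F m n) : typed_comb m n (psi f).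
Proof. by move=> p /mapP[q _ ->]; apply: typed_psi_term. Qed.

(** Distinct matrices give distinct values at [gens], so the coefficient of the evaluated
    combination at the value of [psi_term s] is exactly [fcoef] at [s]. *)
Lemma psi_inj m n (f1 f2 : fcomb F m n) : eqP_V V m n (psi f1) (psi f2) ->
  forall s, fcoef f1 s = fcoef f2 s.
Proof.
move=> /Ideal_EH_zero /(_ _ (size_gens m)) h s.
have := h (eval (psi_term s) (gens m)); rewrite big_cat !big_map /=.
have e (f : fcomb F m n) : (\sum_(p <- f | eval (psi_term p.2) (gens m) ==
    eval (psi_term s) (gens m)) p.1 = fcoef f s)%R.
  apply: eq_bigl => p; apply/eqP/eqP => [/eval_psi_term_inj //|-> //].
rewrite e; under [X in (_ + X)%R]eq_bigr do rewrite mulN1r.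
by rewrite sumrN e => /eqP; rewrite subr_eq0 => /eqP.
Qed.

Lemma psi_surj m n (c : comb F) : typed_comb m n c ->
  exists f : fcomb F m n, eqP_V V m n c (psi f).
Proof.
(* Normal forms are only known to exist, so a choice function is built along the finite list, with
   one matrix for all occurrences of a term. *)
move=> tc; have [f hf] : exists f : tm -> 'M[int]_(n, m),
    forall p, p \in c -> teq F p.2 (psi_term (f p.2)).
  elim: c tc => [|[x t] c IH] tc; first by exists (fun=> 0%R).
  have [s hs] := teq_psi_term (tc _ (mem_head _ _)).
  have [p pc|f hf] := IH; first by apply: tc; rewrite inE pc orbT.
  exists (fun t' => if t' == t then s else f t') => p; rewrite inE.
  case: (p.2 =P t) => [->|ne]; first by [].
  by case/orP => [/eqP e|/hf //]; rewrite e in ne.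
exists [seq (p.1, f p.2) | p <- c].
have := @Ideal_sum m n [seq (p.1, (p.2, psi_term (f p.2))) | p <- c].
rewrite /eqP_V /psi -!map_comp => h.
have e : [seq (p.1, p.2) | p <- c] = c by rewrite -[RHS]map_id; apply: eq_map => -[].
rewrite -[X in X ++ _]e; apply: h => _ /mapP[p pc ->] /=; split; [exact: tc|exact: hf].
Qed.

Lemma EH_zero_Ideal m n (c : comb F) : typed_comb m n c -> EH_zero m c -> Ideal V m n c.
Proof.
move=> tc ec; have [f hf] := psi_surj tc.
have fz s : fcoef f s = 0%R.
  have := Ideal_EH_zero hf (size_gens m) (eval (psi_term s) (gens m)).
  rewrite big_cat /= (ec _ (size_gens m)) add0r !big_map /=.
  under eq_bigr do rewrite mulN1r.
  rewrite sumrN => /eqP; rewrite oppr_eq0 => /eqP <-.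
  by apply: eq_bigl => p; apply/eqP/eqP => [-> //|/eval_psi_term_inj //].
(* [psi f] has zero coefficients, so [c] and the ideal element [c - psi f] are the same vector;
   [fiber_sum] passes from coefficients on matrices to coefficients on terms. *)
apply: Id_rep hf tc _ => t; rewrite !coef_indic big_cat /= !big_map /=.
under [X in (_ + X)%R]eq_bigr do rewrite mulN1r mulNr.
have e := @fiber_sum F _ _ f id fz (fun s => (psi_term s == t)%:R)%R.
by rewrite /= in e; rewrite sumrN e subr0.
Qed.
End Main.

Theorem mainTheorem9 (F : fieldType) :
  (* psi_{m,n} : k F_Ab(x_1..x_m)^{(x) n} -> P_CommCocHopf(k)(m,n) is a linear
     bijection (linearity holds by construction: psi is defined as the
     linear extension of its values on the standard basis) *)
  (forall m n : nat,
     (* psi lands in P(m,n) *)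
     (forall f : fcomb F m n, typed_comb m n (psi f)) /\
     (* injective *)
     (forall f1 f2 : fcomb F m n,
        eqP_V (@V_CommCocHopf F) m n (psi f1) (psi f2) ->
        forall s, fcoef f1 s = fcoef f2 s) /\
     (* surjective *)
     (forall c : comb F, typed_comb m n c ->
        exists f : fcomb F m n, eqP_V (@V_CommCocHopf F) m n c (psi f))) /\
  (* V_CommCocHopf generates the identities of k F_Ab(x_1, x_2, ...) *)
  ((forall m n (c : comb F), V_CommCocHopf m n c -> EH_zero m c) /\
   (forall m n (c : comb F), typed_comb m n c -> EH_zero m c ->
      Ideal (@V_CommCocHopf F) m n c)).
Proof.
split=> [m n|]; first by split; [exact: psi_typed|split; [exact: psi_inj|exact: psi_surj]].
by split=> m n c; [exact: V_EH_zero|exact: EH_zero_Ideal].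
Qed.
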